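(* There is a positive absolute constant $c$ such that the following holds. Let $p$ be a prime and $n$ a positive integer with $5n < \log_2\log_6\log_{18} p - 1$, and let $\mathcal{P}$ be a set of points and $\mathcal{L}$ a set of lines in $\mathbb{F}_p^2$ with $|\mathcal{P}|, |\mathcal{L}| \leq n$. Then $$|\{(q, l) \in \mathcal{P} \times \mathcal{L} : q \in l\}| \leq cn^{4/3}.$$ Moreover, this inequality is sharp up to the constant $c$: there is an absolute constant $c'>0$ such that for every such $p$ and every $n\geq 8$ with $5n < \log_2\log_6\log_{18} p - 1$ there exist a set $\mathcal{P}$ of points and a set $\mathcal{L}$ of lines in $\mathbb{F}_p^2$ with $|\mathcal{P}|,|\mathcal{L}|\leq n$ and at least $c' n^{4/3}$ incidences.
   Context: A line in $\mathbb{F}_p^2$ is a set of the form $\{(x,y)\in\mathbb{F}_p^2 : ay+bx+c=0\}$ with $(a,b)\neq(0,0)$. *)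

(* Defs.v *)
From mathcomp Require Import all_boot all_order all_algebra.
From mathcomp Require Import reals exp.

Set Implicit Arguments.
Unset Strict Implicit.
Unset Printing Implicit Defensive.

Import Order.TTheory GRing.Theory Num.Theory.
Local Open Scope ring_scope.

(* Since [ln x = 0] for [x <= 0], an iterated logarithm with a nonpositive inner
   value is 0; a hypothesis [5 * n%:R < logb _ _ - 1] then fails. *)
Definition logb (R : realType) (b x : R) : R := ln x / ln b.

Definition is_line (F : finFieldType) (l : {set F * F}) : Prop :=
  exists a b c : F, (a, b) <> (0, 0) /\
    l = [set q : F * F | a * q.2 + b * q.1 + c == 0].

Definition incidences (F : finFieldType) (P : {set F * F})
    (L : {set {set F * F}}) : {set (F * F) * {set F * F}} :=
  [set ql in setX P L | ql.1 \in ql.2].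

(* Main.v *)
Require Import Defs.
From mathcomp Require Import all_boot all_order all_algebra perm.
From mathcomp Require Import boolp reals exp.
From mathcomp Require Import complex ring lra zify.

Set Implicit Arguments.
Unset Strict Implicit.
Unset Printing Implicit Defensive.

Import Order.TTheory GRing.Theory Num.Theory.
Local Open Scope ring_scope.

(** Upper bound.  A configuration of at most [n] points is described by the
    vanishing and nonvanishing of the determinants of its triples of points.
    Eliminating the [2 n] coordinates one at a time, with minors of Sylvester
    type matrices and a doubly exponential control of degrees and coefficients,
    shows that for [p] this large the same determinantal conditions have a
    solution over the complex numbers, so it suffices to prove the
    Szemeredi-Trotter theorem in the complex plane.

    There, let [n] lines be given and consider the points on at least [d] of
    them.  Take a smallest disc of slopes holding a small fixed proportion of
    the lines.  The points having few lines with slope in the disc, or few with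
    slope outside a ten times larger concentric disc, are counted by induction
    on [n]: the numbers [n1], [n2] of remaining lines satisfy
    [n1 ^ 2 + n2 ^ 2 < n ^ 2].  The other points lie on many lines of two
    transversal families.  For a point [p] of a line [l], consider the disc of
    [l] around [p] reaching to the nearest other point of [l]; on a fixed line
    these discs overlap boundedly, so few pairs [(p, l)] have about [d ^ 2]
    lines of the other family crossing the disc.  But every [p] has many such
    lines [l] in one of the families: otherwise the lines of a family through
    the neighbours of [p] cross the lines of the other family through [p] much
    closer to [p], relative to the distance of the neighbours, and applying
    this in both directions is contradictory.

    Lower bound.  The points [(x, y)] with [x < k], [y < 2 k ^ 2] and the lines
    [y = a x + b] with [a < k], [b < k ^ 2] have [k ^ 4] incidences. *)

(** * Squared norm on the complex numbers *)

Section SquaredNorm.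
Variable R : rcfType.
Implicit Types z w : R[i].

Definition sqn z : R := complex.Re z ^+ 2 + complex.Im z ^+ 2.

Lemma sqn_ge0 z : 0 <= sqn z.
Proof. by rewrite addr_ge0 ?sqr_ge0. Qed.

Lemma sqn0 : sqn 0 = 0. Proof. by rewrite /sqn /= expr0n addr0. Qed.

Lemma sqn_eq0 z : (sqn z == 0) = (z == 0).
Proof.
rewrite /sqn paddr_eq0 ?sqr_ge0 // !sqrf_eq0.
by case: z => a b; rewrite eq_complex /=.
Qed.

Lemma sqn_gt0 z : (0 < sqn z) = (z != 0).
Proof. by rewrite lt0r sqn_eq0 sqn_ge0 andbT. Qed.

Lemma sqnM z w : sqn (z * w) = sqn z * sqn w.
Proof. by case: z w => [a b] [c d]; rewrite /sqn /=; ring. Qed.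

Lemma sqnN z : sqn (- z) = sqn z.
Proof. by case: z => a b; rewrite /sqn /= !sqrrN. Qed.

Lemma sqnB_le z w : sqn (z - w) <= 2 * sqn z + 2 * sqn w.
Proof.
case: z w => [a b] [c d]; rewrite /sqn /=.
by have := sqr_ge0 (a + c); have := sqr_ge0 (b + d); nra.
Qed.

(* Three signs encoding the octant of the plane that contains [z]. *)
Definition octant z : bool * bool * bool :=
  (0 <= complex.Re z, 0 <= complex.Im z,
   complex.Re z ^+ 2 <= complex.Im z ^+ 2).

(** Vectors of one octant make an angle of at most 45 degrees, so twice their inner product is at
    least the squared length of the shorter one. *)
Lemma octant_close z w :
  octant z = octant w -> sqn z <= sqn w -> sqn (w - z) <= sqn w.
Proof.
case: z w => [a b] [c d]; rewrite /octant /sqn /= => -[h1 h2 h3] h.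
suff : a ^+ 2 + b ^+ 2 <= 2 * (a * c + b * d) by nra.
have [ac0 bd0] : 0 <= a * c /\ 0 <= b * d.
  split.
    case: (lerP 0 a) h1 => ha; case: (lerP 0 c) => hc // _; nra.
  case: (lerP 0 b) h2 => hb; case: (lerP 0 d) => hd // _; nra.
have acE : (a * c) ^+ 2 = a ^+ 2 * c ^+ 2 by ring.
have bdE : (b * d) ^+ 2 = b ^+ 2 * d ^+ 2 by ring.
have := sqr_ge0 a; have := sqr_ge0 b; have := sqr_ge0 c; have := sqr_ge0 d.
move: (a ^+ 2) (b ^+ 2) (c ^+ 2) (d ^+ 2) (a * c) (b * d) ac0 bd0 acE bdE h h3.
move=> A B C D u v u0 v0 uE vE h h3 D0 C0 B0 A0.
rewrite -ler_sqr ?nnegrE ?addr_ge0 ?mulr_ge0 ?addr_ge0 //.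
have -> : (2 * (u + v)) ^+ 2 = 4 * (u ^+ 2 + v ^+ 2 + 2 * (u * v)) by ring.
have uv : 0 <= u * v by exact: mulr_ge0.
rewrite uE vE.
(* The cross term is dropped. Since the octant orders [A, B] as [C, D], Chebyshev's sum inequality
   bounds [A * C + B * D] below by half of [(A + B) * (C + D)]. *)
suff : (A + B) ^+ 2 <= 4 * (A * C + B * D) by lra.
move: h3; case: (lerP A B) => hAB; case: (lerP C D) => hCD // _; nra.
Qed.

End SquaredNorm.

(** * Point-line incidences in the complex plane *)

Section FinsetFacts.
Variable T : finType.
Implicit Types A : {set T}.

Lemma set_ind (P : {set T} -> Prop) :
  P set0 -> (forall a A, a \notin A -> P A -> P (a |: A)) -> forall A, P A.
Proof.
move=> P0 PU A; have [n] := ubnP #|A|; elim: n A => // n IH A hA.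
have [->|[a aA]] := set_0Vmem A; first exact: P0.
rewrite -(setD1K aA); apply: PU; first by rewrite !inE eqxx.
by apply: IH; move: hA; rewrite (cardsD1 a A) aA.
Qed.

Lemma card_bigcup_le (I : finType) (r : {pred I}) (F : I -> {set T}) :
  (#|\bigcup_(i in r) F i| <= \sum_(i in r) #|F i|)%N.
Proof.
elim/big_rec2: _ => [|i n S _ IH]; first by rewrite cards0.
by apply: leq_trans (leq_card_setU _ _) _; rewrite leq_add2l.
Qed.

Lemma subset_with_card A k :
  (k <= #|A|)%N -> exists2 B : {set T}, B \subset A & #|B| = k.
Proof.
move=> hk; exists [set a in take k (enum A)].
  by apply/subsetP => a; rewrite inE => /mem_take; rewrite mem_enum.
rewrite cardsE (card_uniqP _) ?take_uniq ?enum_uniq // size_take -cardE.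
by case: ltngtP hk => // ->.
Qed.

End FinsetFacts.

Section Incidence.
Variables (R : rcfType) (PT LT : finType).
Variables (x y : PT -> R[i]) (s t : LT -> R[i]).
Hypothesis ptI : forall p q, x p = x q -> y p = y q -> p = q.
Hypothesis lnI : forall l m, s l = s m -> t l = t m -> l = m.
Implicit Types (A B S : {set LT}) (Q : {set PT}) (p q : PT) (l m : LT).

(** Slope and intercept exclude vertical lines; configurations are sheared beforehand so that their
    points have distinct abscissas. *)
Definition incident p l := y p == s l * x p + t l.

Definition pencil A p := [set l in A | incident p l].

Lemma on_inj p q l : incident p l -> incident q l -> x p = x q -> p = q.
Proof.
move=> /eqP hp /eqP hq xE; apply: ptI => //.
by rewrite hp hq xE.
Qed.

Lemma on_uniq p q l m :
  p != q -> incident p l -> incident q l -> incident p m -> incident q m -> l = m.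
Proof.
move=> npq pl ql pm qm.
have xpq : x p - x q != 0.
  by rewrite subr_eq0; apply: contra npq => /eqP xE; rewrite (on_inj pl ql xE).
have /eqP: (s l - s m) * (x p - x q) = 0.
  move: pl ql pm qm; rewrite /incident => /eqP h1 /eqP h2 /eqP h3 /eqP h4.
  have e1 : s l * x p + t l = s m * x p + t m by rewrite -h1 -h3.
  have e2 : s l * x q + t l = s m * x q + t m by rewrite -h2 -h4.
  transitivity ((s l * x p + t l) - (s l * x q + t l) -
                ((s m * x p + t m) - (s m * x q + t m))); first by ring.
  by rewrite e1 e2 subrr.
rewrite mulf_eq0 (negbTE xpq) orbF subr_eq0 => /eqP sE; apply: lnI => //.
by move: pl pm; rewrite /incident sE => /eqP -> /eqP /addrI.
Qed.

Lemma card_star_star A p q : p != q -> (#|pencil A p :&: pencil A q| <= 1)%N.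
Proof.
move=> npq; apply/card_le1_eqP => l m; rewrite !inE.
move=> /andP[/andP[_ pl] /andP[_ ql]] /andP[/andP[_ pm] /andP[_ qm]].
exact: on_uniq npq pm qm pl ql.
Qed.

(** Bonferroni's inequality: two points share at most one line, so each pair of points costs at most
    one line of the union. *)
Lemma sum_star_le A Q :
  (2 * (\sum_(p in Q) #|pencil A p|) <=
   2 * #|\bigcup_(p in Q) pencil A p| + #|Q| * #|Q|.-1)%N.
Proof.
elim/set_ind: Q => [|q Q qQ IH]; first by rewrite !big_set0.
rewrite !big_setU1 //= cardsU1 qQ /=.
set U := \bigcup_(p in Q) pencil A p in IH *.
have hI : (#|pencil A q :&: U| <= #|Q|)%N.
  rewrite /U big_distrr /=.
  apply: leq_trans (card_bigcup_le _ _) _.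
  rewrite -sum1_card; apply: leq_sum => p pQ.
  by apply: card_star_star; apply: contraNneq qQ => ->.
have := cardsUI (pencil A q) U.
move: IH hI; case: #|Q| => [|k] /=; nia.
Qed.

(** The Bonferroni correction is quadratic in the number of points, so [Q] is cut down to the least
    [k >= d / 2] points; these already cover [3 * k * d / 4] lines. *)
Lemma union_star_ge A Q (d : R) : 0 <= d ->
  d / 2 <= #|Q|%:R -> (forall p, p \in Q -> d <= #|pencil A p|%:R) ->
  d ^+ 2 / 4 <= #|\bigcup_(p in Q) pencil A p|%:R.
Proof.
move=> d0 hQ hdeg.
pose P k := d / 2 <= k%:R :> R.
have [k hk kmin] : {k | P k & forall j, P j -> (k <= j)%N}.
  by case: (ex_minnP (ex_intro P _ hQ)) => k ? ?; exists k.
have [Q' sQ' cQ'] := subset_with_card (kmin _ hQ).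
have sU : (#|\bigcup_(p in Q') pencil A p| <= #|\bigcup_(p in Q) pencil A p|)%N.
  apply: subset_leq_card; apply/bigcupsP => p pQ'.
  by rewrite bigcup_sup // (subsetP sQ').
have k1 : k.-1%:R <= d / 2.
  case: k kmin {hk cQ'} => [|k] kmin /=; first lra.
  by rewrite leNgt; apply/negP => /ltW /kmin; rewrite ltnn.
have := sum_star_le A Q'; rewrite cQ'.
rewrite -(ler_nat R) natrD !natrM natr_sum.
have hs : k%:R * d <= \sum_(p in Q') #|pencil A p|%:R.
  rewrite -cQ' mulr_natl -sumr_const; apply: ler_sum => p pQ'.
  by apply: hdeg; apply: (subsetP sQ').
move: sU; rewrite -(ler_nat R) => sU.
move: hk; rewrite /P => hk.
move: sU hs k1 hk.
move: (\sum_(_ in _) _) (#|\bigcup_(p in Q') _|%:R) (#|\bigcup_(p in Q) _|%:R).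
move: (k%:R) (k.-1%:R) => K K1 sg u U h1 h2 h3 h4 h5; nra.
Qed.

(** Abscissa of the intersection point. On a fixed line, distances are proportional to differences
    of abscissas, so only abscissas are compared. *)
Definition cross l m := (t m - t l) / (s l - s m).

(** Both sides are the vertical gap between [p] and [m]: it closes along [l] at the crossing with
    [m], and along [k] at [q]. *)
Lemma cross_diff p q l k m : s l != s m ->
  incident p l -> incident p k -> incident q k -> incident q m ->
  (cross l m - x p) * (s l - s m) = (x q - x p) * (s k - s m).
Proof.
rewrite -subr_eq0 => nlm /eqP e1 /eqP e2 /eqP e3 /eqP e4.
rewrite mulrBl divfK //.
have -> : t m = y q - s m * x q by rewrite e4; ring.
have -> : t l = y p - s l * x p by rewrite e1; ring.
have -> : y q = y p + s k * (x q - x p) by rewrite e2 e3; ring.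
by ring.
Qed.

(* The lines of [B] meeting [l] inside the largest open disc of [l] centred at
   [p] that contains no other point of [Q]. *)
Definition cap Q B p l :=
  [set b in B | [forall (q | [&& q \in Q, q != p & incident q l]),
                   sqn (cross l b - x p) < sqn (x q - x p)]].

Lemma capP Q B p l b : b \in cap Q B p l ->
  forall q, q \in Q -> q != p -> incident q l ->
  sqn (cross l b - x p) < sqn (x q - x p).
Proof.
rewrite inE => /andP[_ /forallP h] q qQ qp ql.
by have /implyP := h q; apply; rewrite qQ qp ql.
Qed.

(* Planar discs none of which contains the centre of another one overlap
   boundedly often. *)
Lemma cap_overlap Q B l b :
  (#|[set p in Q | incident p l & b \in cap Q B p l]| <= 8)%N.
Proof.
set E := finset _; pose f p := octant (x p - cross l b).
suff fI : {in E &, injective f}.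
  rewrite -(card_in_imset fI); apply: leq_trans (max_card _) _.
  by rewrite !card_prod card_bool.
(* Of two centres in the same octant around the crossing point, the farther one is at least as close
   to the nearer one as to the crossing, so its disc cannot contain the crossing. Hence one centre
   per octant. *)
suff h p q : p \in E -> q \in E -> f p = f q ->
    sqn (x p - cross l b) <= sqn (x q - cross l b) -> p = q.
  move=> p q pE qE fpq.
  have [hle|/ltW hle] := lerP (sqn (x p - cross l b)) (sqn (x q - cross l b)).
    exact: h.
  by apply/esym; apply: h.
rewrite inE => /and3P[pQ pl pb]; rewrite inE => /and3P[qQ ql qb] fpq hle.
apply/eqP.
apply/negP => /negP npq; have := capP qb pQ npq pl.
rewrite -sqnN opprB ltNge -[X in ~~ (X <= _)]sqnN opprB.
have -> : x q - x p = (x q - cross l b) - (x p - cross l b) by ring.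
by rewrite octant_close.
Qed.

Lemma sum_cap_le Q A B :
  (\sum_(p in Q) \sum_(l in pencil A p) #|cap Q B p l| <= 8 * (#|A| * #|B|))%N.
Proof.
have -> : (\sum_(p in Q) \sum_(l in pencil A p) #|cap Q B p l| =
   \sum_(l in A) \sum_(b in B) #|[set p in Q | incident p l & b \in cap Q B p l]|)%N.
  transitivity (\sum_(p in Q) \sum_(l in A) \sum_(b in B)
                  (incident p l && (b \in cap Q B p l)))%N.
    apply: eq_bigr => p _; rewrite big_mkcond [RHS]big_mkcond /=.
    apply: eq_bigr => l _; rewrite inE; case: (l \in A) => //=.
    case: (incident p l) => /=; last by rewrite big1.
    rewrite -sum1_card big_mkcond [RHS]big_mkcond /=.
    by apply: eq_bigr => b _; rewrite inE; case: (b \in B) => //=; case: ifP.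
  rewrite exchange_big /=; apply: eq_bigr => l _.
  rewrite exchange_big /=; apply: eq_bigr => b _.
  rewrite -sum1_card big_mkcond [RHS]big_mkcond /=.
  apply: eq_bigr => p _; rewrite [p \in finset _]inE.
  by case: (p \in Q) => //=; case: (incident p l) => //=; case: (b \in _).
rewrite mulnC -mulnA -sum_nat_const; apply: leq_sum => l _.
by rewrite -sum_nat_const; apply: leq_sum => b _; exact: cap_overlap.
Qed.

(** On these lines the points of [Q] are sparse around [p]: the disc reaching to the nearest one is
    wide enough to be crossed by [d ^+ 2 / 4] lines of [B]. *)
Definition sparse (d : R) Q A B p :=
  [set l in pencil A p | d ^+ 2 / 4 <= #|cap Q B p l|%:R].

Lemma sum_sparse_le d Q A B :
  (\sum_(p in Q) #|sparse d Q A B p|%:R) * (d ^+ 2 / 4) <=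
  8 * (#|A|%:R * #|B|%:R).
Proof.
have := sum_cap_le Q A B; rewrite -(ler_nat R) !natrM; apply: le_trans.
rewrite natr_sum mulr_suml; apply: ler_sum => p _.
rewrite natr_sum mulr_natl -sumr_const.
rewrite (bigID (mem (sparse d Q A B p)) (mem (pencil A p))) /=.
apply: ler_wpDr; first by apply: sumr_ge0.
rewrite big_mkcond [X in _ <= X]big_mkcond /=; apply: ler_sum => l _.
by rewrite !inE; case: (l \in A); case: (incident p l) => //=; case: ifP.
Qed.

(** * Two families of lines with well separated slopes *)

Section NonSparse.
Variables (d : R) (Q : {set PT}) (p : PT).
Hypothesis d0 : 0 < d.

Definition nonsparse A B := pencil A p :\: sparse d Q A B p.

(** If [l] carried no other point of [Q], its cap would be all of [B], which has at least
    [d ^+ 2 / 4] lines, and [l] would be sparse. So a nearest point exists. *)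
Lemma nonsparse_neighbour A B : d ^+ 2 <= 4 * #|B|%:R ->
  exists nb : LT -> PT, forall l, l \in nonsparse A B ->
    [/\ nb l \in Q, nb l != p, incident (nb l) l &
     forall b, b \in B -> sqn (cross l b - x p) < sqn (x (nb l) - x p) ->
       b \in cap Q B p l].
Proof.
move=> hB.
have h l : exists q, l \in nonsparse A B -> [/\ q \in Q, q != p, incident q l &
     forall b, b \in B -> sqn (cross l b - x p) < sqn (x q - x p) ->
       b \in cap Q B p l].
  have [lN|] := boolP (l \in nonsparse A B); last by exists p.
  have hcap : #|cap Q B p l|%:R < d ^+ 2 / 4.
    move: lN; rewrite !inE => /andP[h /andP[lA lp]]; move: h.
    by rewrite lA lp /= -ltNge.
  have [q0 hq0] : exists q, [&& q \in Q, q != p & incident q l].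
    apply/existsP/contraT => /existsPn hn; exfalso.
    suff capE : cap Q B p l = B by move: hcap; rewrite capE; lra.
    apply/setP => b; rewrite inE; case: (b \in B) => //=.
    by apply/forall_inP => q hq; have := hn q; rewrite hq.
  case: (@arg_minP _ _ _ q0 (fun q => [&& q \in Q, q != p & incident q l])
           (fun q => sqn (x q - x p)) hq0) => q /and3P[qQ qp ql] qmin.
  exists q => _; split => // b bB hb; rewrite inE bB /=.
  by apply/forall_inP => q' hq'; apply: lt_le_trans hb _; apply: qmin.
exact: fin_all_exists h.
Qed.

Lemma card_nonsparse A B :
  #|sparse d Q A B p|%:R < d / 2 -> d <= #|pencil A p|%:R ->
  d / 2 <= #|nonsparse A B|%:R.
Proof.
move=> h1 h2; have := cardsID (sparse d Q A B p) (pencil A p).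
rewrite (setIidPr _); last by apply/subsetP => l; rewrite inE => /andP[].
rewrite /nonsparse => /(congr1 (fun n => n%:R : R)); rewrite natrD; lra.
Qed.

(* The lines of [A] through the neighbours of [p] on its nonsparse [A]-lines
   are too many to meet a nonsparse [B]-line [v] all close to [p]. *)
Lemma nonsparse_far A B (na nb : LT -> PT) v :
  (forall q, q \in Q -> d <= #|pencil A q|%:R) ->
  d / 2 <= #|nonsparse A B|%:R ->
  (forall l, l \in nonsparse A B -> [/\ na l \in Q, na l != p & incident (na l) l]) ->
  v \in nonsparse B A ->
  (forall b, b \in A -> sqn (cross v b - x p) < sqn (x (nb v) - x p) ->
       b \in cap Q A p v) ->
  exists l h, [/\ l \in nonsparse A B, h \in A, incident (na l) h &
    sqn (x (nb v) - x p) <= sqn (cross v h - x p)].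
Proof.
move=> hdeg hN hna vN hcap.
have naI : {in nonsparse A B &, injective na}.
  move=> l m lN mN e; have [_ npl nl] := hna _ lN; have [_ _ nm] := hna _ mN.
  have pN k : k \in nonsparse A B -> incident p k.
    by rewrite !inE => /andP[_ /andP[]].
  by rewrite -e in nm; exact: (on_uniq npl nl (pN _ lN) nm (pN _ mN)).
pose Q' := [set na l | l in nonsparse A B].
have hU : d ^+ 2 / 4 <= #|\bigcup_(q in Q') pencil A q|%:R.
  apply: union_star_ge (ltW d0) _ _; first by rewrite card_in_imset.
  by move=> q /imsetP[l lN ->]; apply: hdeg; have [] := hna _ lN.
have /subsetPn[h /bigcupP[q /imsetP[l lN ->] hq] hcapn] :
    ~~ (\bigcup_(q in Q') pencil A q \subset cap Q A p v).
  apply/negP => /subset_leq_card; rewrite -(ler_nat R) => hle.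
  move: vN; rewrite !inE => /andP[h /andP[vB vp]]; move: h.
  by rewrite vB vp /= (le_trans hU hle).
move: hq; rewrite inE => /andP[hA hq].
exists l, h; split => //; rewrite leNgt; apply/negP => hlt.
by move: hcapn; rewrite hcap.
Qed.

(** Otherwise some [A]-line through a neighbour of [p] meets any given nonsparse [B]-line no closer
    to [p] than its own neighbour, and symmetrically. Applied to extremal lines [l] and [v], the two
    length comparisons are incompatible because the slopes are a factor ten apart. *)
Lemma sparse_or A B (z0 : R[i]) (sg : R) : 0 < sg -> p \in Q ->
  (forall l, l \in A -> sqn (s l - z0) <= sg) ->
  (forall l, l \in B -> 100 * sg <= sqn (s l - z0)) ->
  d ^+ 2 <= 4 * #|A|%:R -> d ^+ 2 <= 4 * #|B|%:R ->
  (forall q, q \in Q -> d <= #|pencil A q|%:R) ->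
  (forall q, q \in Q -> d <= #|pencil B q|%:R) ->
  d / 2 <= #|sparse d Q A B p|%:R \/ d / 2 <= #|sparse d Q B A p|%:R.
Proof.
move=> sg0 pQ hA hB dA dB degA degB.
have [|spA] := lerP (d / 2) #|sparse d Q A B p|%:R; first by left.
have [|spB] := lerP (d / 2) #|sparse d Q B A p|%:R; first by right.
exfalso.
have nA := card_nonsparse spA (degA _ pQ).
have nB := card_nonsparse spB (degB _ pQ).
have [na hna] := nonsparse_neighbour A dB.
have [nb hnb] := nonsparse_neighbour B dA.
have inA l : l \in nonsparse A B -> (l \in A) && incident p l.
  by rewrite !inE => /andP[_].
have inB l : l \in nonsparse B A -> (l \in B) && incident p l.
  by rewrite !inE => /andP[_].
have sne l m : l \in A -> m \in B -> s l != s m.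
  move=> /hA h1 /hB h2; apply: contraTneq h1 => ->; rewrite -ltNge; lra.
have [l0 l0N] : exists l, l \in nonsparse A B.
  by apply/card_gt0P; rewrite -(ltr_nat R); apply: lt_le_trans nA; rewrite divr_gt0.
have [m0 m0N] : exists l, l \in nonsparse B A.
  by apply/card_gt0P; rewrite -(ltr_nat R); apply: lt_le_trans nB; rewrite divr_gt0.
case: (@arg_maxP _ _ _ l0 (fun l => l \in nonsparse A B)
         (fun l => sqn (x (na l) - x p)) l0N) => l lN lmax {l0 l0N}.
(* The weight is the squared change of [y - z0 * x] between [p] and its neighbour, so [B]-lines of
   different steepness become comparable. *)
case: (@arg_maxP _ _ _ m0 (fun l => l \in nonsparse B A)
         (fun l => sqn (s l - z0) * sqn (x (nb l) - x p)) m0N)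
  => v vN vmax {m0 m0N}.
have hna' k : k \in nonsparse A B -> [/\ na k \in Q, na k != p & incident (na k) k].
  by move=> /hna[].
have hnb' k : k \in nonsparse B A -> [/\ nb k \in Q, nb k != p & incident (nb k) k].
  by move=> /hnb[].
have [l1 [h [l1N hhA hon hfar]]] : exists l1 h, [/\ l1 \in nonsparse A B, h \in A,
    incident (na l1) h & sqn (x (nb v) - x p) <= sqn (cross v h - x p)].
  by apply: nonsparse_far => //; have [] := hnb _ vN.
have [v1 [b [v1N hbB bon bfar]]] : exists v1 b, [/\ v1 \in nonsparse B A, b \in B,
    incident (nb v1) b & sqn (x (na l) - x p) <= sqn (cross l b - x p)].
  by apply: nonsparse_far => //; have [] := hna _ lN.
have [/andP[lA pl] /andP[vB pv]] := (inA _ lN, inB _ vN).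
have [/andP[l1A pl1] /andP[v1B pv1]] := (inA _ l1N, inB _ v1N).
have T0 : 0 < sqn (x (na l) - x p).
  rewrite sqn_gt0 subr_eq0; have [_ npl nl] := hna' _ lN.
  by apply: contra npl => /eqP e; apply/eqP; apply: (on_inj nl pl e).
have svh : s v != s h by rewrite eq_sym; apply: sne.
have e1 := congr1 (@sqn R)
  (cross_diff svh pv pl1 (let: And3 _ _ c := hna' _ l1N in c) hon).
have e2 := congr1 (@sqn R)
  (cross_diff (sne _ _ lA hbB) pl pv1 (let: And3 _ _ c := hnb' _ v1N in c) bon).
rewrite !sqnM in e1 e2.
have sub a c : s a - s c = (s a - z0) - (s c - z0) by ring.
have lo a c : sqn (s a - z0) / 2 - sqn (s c - z0) <= sqn (s a - s c).
  have := sqnB_le ((s a - z0) - (s c - z0)) (- (s c - z0)).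
  by rewrite opprK subrK sqnN -sub; lra.
have hi a c : sqn (s a - s c) <= 2 * sqn (s a - z0) + 2 * sqn (s c - z0).
  by rewrite (sub a c) sqnB_le.
have q1 := lo v h; have q2 := hi l1 h; have q3 := lo b l; have q4 := hi v1 b.
have a1 := hA _ lA; have a2 := hA _ l1A; have a3 := hA _ hhA.
have b1 := hB _ vB; have b2 := hB _ v1B; have b3 := hB _ hbB.
have m1 := lmax _ l1N; have m2 := vmax _ v1N; rewrite /= in m1 m2.
have g1 := sqn_ge0 (x (nb v1) - x p).
have g2 := sqn_ge0 (x (nb v) - x p).
have g3 := sqn_ge0 (x (na l1) - x p).
rewrite -[X in _ * sqn X = _]opprB sqnN in e2.
move: (sqn (x (na l) - x p)) (sqn (x (nb v) - x p)) (sqn (x (na l1) - x p))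
  (sqn (x (nb v1) - x p)) (sqn (s v - z0)) (sqn (s b - z0)) (sqn (s v1 - z0))
  (sqn (s h - z0)) (sqn (s l - z0)) (sqn (s l1 - z0)) (sqn (s v - s h))
  (sqn (s l1 - s h)) (sqn (s b - s l)) (sqn (s v1 - s b))
  (sqn (cross v h - x p)) (sqn (cross l b - x p))
  sg0 T0 e1 e2 hfar bfar q1 q2 q3 q4 a1 a2 a3 b1 b2 b3 m1 m2 g1 g2 g3.
clear -R sg; move=> T D T1 D2 W Wb W1 wh wl wl1 N1 N2 N3 N4 c1 c2.
move=> sg0 T0 e1 e2 hfar bfar q1 q2 q3 q4 a1 a2 a3 b1 b2 b3 m1 m2 g1 g2 g3.
(* As [W >= 100 * sg], the squared slope difference [N1] is at least [W / 2 - sg >= 49 / 100 * W],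
   while [N2 <= 4 * sg]. *)
have k1 : 49 / 100 * (W * D) <= 4 * (sg * T).
  apply: (@le_trans _ _ (D * N1)); first nra.
  apply: (@le_trans _ _ (c1 * N1)); first nra.
  rewrite e1; apply: (@le_trans _ _ (T1 * (4 * sg))); nra.
have k2 : 100 * sg * D2 <= W * D by nra.
have k3 : 49 / 100 * (Wb * T) <= 2 * (W * D) + 2 * (Wb * D2).
  apply: (@le_trans _ _ (c2 * N3)); first nra.
  rewrite e2; apply: (@le_trans _ _ (D2 * (2 * W1 + 2 * Wb))); nra.
have k4 : 49 * (sg * T) <= 4 * (W * D).
  have Wb0 : 0 < Wb by lra.
  rewrite -(ler_pM2l Wb0).
  have : 100 * sg * (49 / 100 * (Wb * T)) <=
         100 * sg * (2 * (W * D) + 2 * (Wb * D2)) by rewrite ler_pM2l //; lra.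
  have : 0 <= W * D * (Wb - 100 * sg).
    by rewrite !mulr_ge0 // ?subr_ge0 //; lra.
  have : 0 <= Wb * (W * D - 100 * sg * D2).
    by rewrite mulr_ge0 ?subr_ge0 //; lra.
  lra.
(* By [k4] and [k1], [49 * (sg * T)] is at most [1600 / 49 * (sg * T)], which is absurd. *)
have : 0 < sg * T by rewrite mulr_gt0.
lra.
Qed.

End NonSparse.

(** Each point has [d / 2] sparse lines in one of the families, each crossed by [d ^+ 2 / 4] lines
    within its cap, and bounded overlap allows [8 * #|A| * #|B|] such crossings per family. *)
Lemma two_families A B Q (z0 : R[i]) (sg d : R) : 0 < d -> 0 < sg ->
  (forall l, l \in A -> sqn (s l - z0) <= sg) ->
  (forall l, l \in B -> 100 * sg <= sqn (s l - z0)) ->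
  d ^+ 2 <= 4 * #|A|%:R -> d ^+ 2 <= 4 * #|B|%:R ->
  (forall q, q \in Q -> d <= #|pencil A q|%:R) ->
  (forall q, q \in Q -> d <= #|pencil B q|%:R) ->
  #|Q|%:R * d ^+ 3 <= 128 * (#|A|%:R * #|B|%:R).
Proof.
move=> d0 sg0 hA hB dA dB degA degB.
have hs : #|Q|%:R * (d / 2) <=
    \sum_(p in Q) #|sparse d Q A B p|%:R + \sum_(p in Q) #|sparse d Q B A p|%:R.
  rewrite -big_split /= mulr_natl -sumr_const; apply: ler_sum => p pQ.
  have [h|h] := sparse_or d0 sg0 pQ hA hB dA dB degA degB.
    by rewrite ler_wpDr.
  by rewrite ler_wpDl.
have h1 := sum_sparse_le d Q A B; have h2 := sum_sparse_le d Q B A.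
have d2 : 0 < d ^+ 2 / 4 by rewrite divr_gt0 ?exprn_gt0.
move: hs; rewrite -(ler_pM2r d2) mulrDl => hs.
have -> : #|Q|%:R * d ^+ 3 = 8 * (#|Q|%:R * (d / 2) * (d ^+ 2 / 4)) by field.
rewrite (mulrC #|B|%:R) in h2; lra.
Qed.

End Incidence.

(** * Concentration of slopes in discs *)

Section DenseDisc.
Variables (R : realType) (LT : finType) (s : LT -> R[i]).
Implicit Types (S : {set LT}).

Lemma Re_lt (z : R[i]) (r : R) : 0 <= r -> sqn z < r ^+ 2 ->
  `|complex.Re z| < r /\ `|complex.Im z| < r.
Proof.
case: z => a b; rewrite /sqn /= => r0 h; have := sqr_ge0 a; have := sqr_ge0 b.
move=> b2 a2; split; rewrite -(ltr_sqr (normr_ge0 _) r0) real_normK ?num_real //; lra.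
Qed.

Lemma truncn_close (u v : R) :
  0 <= u -> 0 <= v -> Num.truncn u = Num.truncn v -> (u - v) ^+ 2 <= 1.
Proof.
move=> /truncn_itv/andP[u1 u2] /truncn_itv/andP[v1 v2] e.
rewrite -e -natr1 in v1 v2; rewrite -natr1 in u2; nra.
Qed.

(* A disc of least radius among those holding at least [w] slopes; the
   concentric disc of ten times its radius is covered by 1600 squares, each
   inside a smaller disc. *)
Lemma dense_disc S (w : R) : 0 < w -> w <= #|S|%:R ->
  exists (z0 : R[i]) (sg : R), [/\ 0 <= sg,
    w <= #|[set l in S | sqn (s l - z0) <= sg]|%:R &
    0 < sg -> #|[set l in S | sqn (s l - z0) < 100 * sg]|%:R <= 1600 * w].
Proof.
move=> w0 wS; pose disc l r := [set m in S | sqn (s m - s l) <= r].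
pose P (lm : LT * LT) := [&& lm.1 \in S, lm.2 \in S &
  w <= #|disc lm.1 (sqn (s lm.2 - s lm.1))|%:R].
(* A disc can be shrunk until a slope lies on its boundary, so the least radius is sought among
   finitely many pairs of lines. *)
have far l r : l \in S -> 0 <= r -> exists2 m, m \in disc l r &
    disc l (sqn (s m - s l)) = disc l r.
  move=> lS r0; have l_disc : l \in disc l r by rewrite inE lS subrr sqn0.
  case: (@arg_maxP _ _ _ l (fun m => m \in disc l r)
           (fun m => sqn (s m - s l)) l_disc) => m mD mmax.
  exists m => //; apply/setP => k; rewrite !inE; case kS: (k \in S) => //=.
  apply/idP/idP => [h|h]; first by move: mD; rewrite inE => /andP[_]; apply: le_trans.
  by apply: mmax; rewrite inE kS.
have [lm Plm] : exists lm, P lm.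
  have [l lS] : exists l, l \in S.
    by apply/card_gt0P; rewrite -(ltr_nat R); apply: lt_le_trans wS.
  pose r := \sum_(m in S) sqn (s m - s l).
  have r0 : 0 <= r by apply: sumr_ge0 => m _; exact: sqn_ge0.
  have [m mD Dm] := far l r lS r0; exists (l, m); rewrite /P /= lS Dm.
  have -> : disc l r = S.
    apply/setP => k; rewrite inE; case kS: (k \in S) => //=.
    rewrite /r (bigD1 k) //= lerDl sumr_ge0 // => i _; exact: sqn_ge0.
  by rewrite wS andbT; move: mD; rewrite inE => /andP[].
case: (@arg_minP _ _ _ lm P (fun lm => sqn (s lm.2 - s lm.1)) Plm).
move=> [l m] /and3P[/= lS mS hw] lmin {lm Plm}.
exists (s l), (sqn (s m - s l)); split => //; first exact: sqn_ge0.
move: hw lmin; set sg := sqn _ => hw lmin sg0.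
have small k : k \in S -> #|disc k (sg / 2)|%:R <= w.
  move=> kS; rewrite leNgt; apply/negP => hlt.
  have [|k' k'D Dk] := far k (sg / 2) kS; first lra.
  have k'S : k' \in S by move: k'D; rewrite inE => /andP[].
  have := lmin (k, k'); rewrite /P /= kS k'S Dk (ltW hlt) => /(_ isT).
  by move: k'D; rewrite inE => /andP[_]; lra.
pose rho := Num.sqrt sg.
have rho0 : 0 < rho by rewrite sqrtr_gt0.
have rho2 : rho ^+ 2 = sg by rewrite sqr_sqrtr ?ltW.
(* The large disc lies in a square of side [20 * rho], cut into 40 by 40 cells of side [rho / 2].
   The squared diameter of a cell is [sg / 2], below the minimal [sg]. By [bnd], the default of
   [inord] is never reached. *)
pose ix (a : R) : 'I_40 := inord (Num.truncn (2 * a / rho + 20)).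
pose cell k := (ix (complex.Re (s k - s l)), ix (complex.Im (s k - s l))).
have bnd a : `|a| < 10 * rho -> 0 <= 2 * a / rho + 20 < 40.
  rewrite ltr_norml => /andP[h1 h2].
  have : - 20 < 2 * a / rho by rewrite ltr_pdivlMr //; lra.
  have : 2 * a / rho < 20 by rewrite ltr_pdivrMr //; lra.
  by move=> ? ?; apply/andP; split; lra.
have ixP a b : `|a| < 10 * rho -> `|b| < 10 * rho -> ix a = ix b ->
    (a - b) ^+ 2 <= sg / 4.
  move=> /bnd /andP[a1 a2] /bnd /andP[b1 b2] /(congr1 (@nat_of_ord _)).
  have lt40 u : 0 <= u -> u < 40 -> (Num.truncn u < 40)%N.
    by move=> u0 u40; rewrite truncn_lt_nat.
  rewrite !inordK ?lt40 // => /(truncn_close a1 b1).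
  have -> : 2 * a / rho + 20 - (2 * b / rho + 20) = 2 * (a - b) / rho.
    by field; rewrite gt_eqF.
  rewrite expr_div_n ler_pdivrMr ?exprn_gt0 // mul1r rho2 exprMn.
  by lra.
set D := finset _.
have -> : #|D| = (\sum_(c : 'I_40 * 'I_40) #|[set k in D | cell k == c]|)%N.
  rewrite -sum1_card (partition_big cell predT) //=.
  by apply: eq_bigr => c _; rewrite -sum1_card; apply: eq_bigl => k; rewrite inE.
have -> : 1600 * w = \sum_(c : 'I_40 * 'I_40) w.
  by rewrite sumr_const card_prod !card_ord -[RHS]mulr_natl natrM; ring.
rewrite natr_sum; apply: ler_sum => c _.
have [->|[k]] := set_0Vmem [set k in D | cell k == c].
  by rewrite cards0 ltW.
rewrite !inE => /andP[/andP[kS kD] /eqP kc].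
apply: le_trans (small k kS); rewrite ler_nat subset_leq_card //.
apply/subsetP => j; rewrite !inE => /andP[/andP[-> jD] /eqP jc] /=.
have rho10 : 0 <= 10 * rho by rewrite mulr_ge0 ?ltW.
have D10 i : sqn (s i - s l) < 100 * sg -> sqn (s i - s l) < (10 * rho) ^+ 2.
  by rewrite exprMn rho2; lra.
have [ka kb] := Re_lt rho10 (D10 _ kD); have [ja jb] := Re_lt rho10 (D10 _ jD).
move: jc; rewrite -kc => -[/(ixP _ _ ja ka) h1 /(ixP _ _ jb kb) h2].
have -> : s j - s k = (s j - s l) - (s k - s l) by ring.
move: h1 h2; case: (s j - s l) (s k - s l) => [a b] [a' b'].
by rewrite /sqn /= => h1 h2; lra.
Qed.

End DenseDisc.

(** * Number of points on at least [d] lines *)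

Section RichPoints.
Variables (R : realType) (PT LT : finType).
Variables (x y : PT -> R[i]) (s t : LT -> R[i]).
Hypothesis ptI : forall p q, x p = x q -> y p = y q -> p = q.
Hypothesis lnI : forall l m, s l = s m -> t l = t m -> l = m.
Implicit Types (A B S : {set LT}) (Q : {set PT}) (p q : PT) (l m : LT).

Local Notation on := (incident x y s t).
Local Notation star := (pencil x y s t).

(** Take the least number [k] of points violating the bound: [k - 1 <= d / 2], so by Bonferroni
    their pencils cover at least [3 * k * d / 4] lines, more than [S] has. *)
Lemma very_rich_le S Q (d : R) : 0 < d -> 4 * #|S|%:R <= d ^+ 2 ->
  (forall p, p \in Q -> d <= #|star S p|%:R) -> #|Q|%:R * d <= 2 * #|S|%:R.
Proof.
move=> d0 dS hdeg; rewrite leNgt; apply/negP => hlt.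
pose P k := 2 * #|S|%:R < k%:R * d.
have [k hk kmin] : {k | P k & forall j, P j -> (k <= j)%N}.
  by case: (ex_minnP (ex_intro P _ hlt)) => k ? ?; exists k.
have [Q' sQ' cQ'] := subset_with_card (kmin _ hlt).
have sU : (#|\bigcup_(p in Q') star S p| <= #|S|)%N.
  apply: subset_leq_card; apply/bigcupsP => p _.
  by apply/subsetP => l; rewrite inE => /andP[].
have k1 : k.-1%:R <= d / 2.
  case: k kmin hk {cQ'} => [|k] kmin hk /=; first lra.
  have : k%:R * d <= 2 * #|S|%:R.
    by rewrite leNgt; apply/negP => /kmin; rewrite ltnn.
  by move=> h; rewrite -(ler_pM2r d0); apply: le_trans h _; lra.
have := sum_star_le ptI lnI S Q'; rewrite cQ'.
rewrite -(ler_nat R) natrD !natrM natr_sum.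
have hs : k%:R * d <= \sum_(p in Q') #|star S p|%:R.
  rewrite -cQ' mulr_natl -sumr_const; apply: ler_sum => p pQ'.
  by apply: hdeg; apply: (subsetP sQ').
move: sU; rewrite -(ler_nat R) => sU.
have := ler_wpM2l (ler0n R k) k1; have := ler0n R #|S|.
move: hk; rewrite /P; lra.
Qed.

Lemma rich_le_sqr S Q :
  (forall p, p \in Q -> (1 < #|star S p|)%N) -> (#|Q| <= #|S| ^ 2)%N.
Proof.
move=> hdeg.
have [->|[p0 /hdeg/card_gt1P[l0 _]]] := set_0Vmem Q; first by rewrite cards0.
have h p : exists lm : LT * LT, p \in Q ->
    [/\ lm.1 \in star S p, lm.2 \in star S p & lm.1 != lm.2].
  have [/hdeg/card_gt1P[l [m [? ? ?]]]|_] := boolP (p \in Q); last by exists (l0, l0).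
  by exists (l, m).
have [f hf] := fin_all_exists h.
have fI : {in Q &, injective f}.
  move=> p q pQ qQ e; apply/eqP/negP => /negP npq.
  have [] := hf _ pQ; have [] := hf _ qQ; rewrite e !inE.
  move=> /andP[_ q1] /andP[_ q2] ne /andP[_ p1] /andP[_ p2] _.
  by move: ne; rewrite (on_uniq ptI lnI npq p1 q1 p2 q2) eqxx.
rewrite -(card_in_imset fI) -mulnn -cardsX subset_leq_card //.
apply/subsetP => _ /imsetP[p pQ ->]; rewrite inE.
by have [] := hf _ pQ; rewrite !inE => /andP[-> _] /andP[-> _].
Qed.

(* The value gives [(1 - delta) ^+ 2 + (1600 * delta) ^+ 2 <= 1 - delta], where
   1600 is the covering constant of [dense_disc]. *)
Definition delta : R := (2 * 1600 ^+ 2)^-1.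
(** With this value [(1 - kappa) ^+ 3 >= 1 - delta / 2]: lowering the threshold [d] by the factor
    [1 - kappa] costs only half of the gain [delta]. *)
Definition kappa : R := delta / 6.
(** Its product with the remaining gain [delta / 2] pays for the linear terms of the induction (64)
    and for the points on two families ([128 / kappa ^+ 3]). *)
Definition rich_const : R := 2 / delta * (64 + 128 / kappa ^+ 3).

Lemma delta_gt0 : 0 < delta. Proof. by rewrite invr_gt0 mulr_gt0 ?exprn_gt0. Qed.
Lemma kappa_gt0 : 0 < kappa. Proof. by rewrite divr_gt0 ?delta_gt0. Qed.
Lemma delta_le : 1600 * delta <= 1 / 2.
Proof.
have -> : 1600 * delta = (2 * 1600)^-1 by rewrite /delta; field.
by rewrite mul1r lef_pV2 ?posrE ?mulr_gt0 // ler_peMr // ler1n.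
Qed.

Lemma rich_const_ge : kappa ^- 3 <= rich_const.
Proof.
have k0 := kappa_gt0; have d0 := delta_gt0; have d1 := delta_le.
have kV : 0 < kappa ^- 3 by rewrite invr_gt0 exprn_gt0.
have dV : 1 <= delta^-1 by rewrite invf_ge1 //; lra.
rewrite /rich_const; move: (kappa ^- 3) (delta^-1) kV dV => u v u0 v1; nra.
Qed.

Lemma rich_const_gt0 : 0 < rich_const.
Proof. by apply: lt_le_trans rich_const_ge; rewrite invr_gt0 exprn_gt0 ?kappa_gt0. Qed.

Lemma kappaE : delta = 6 * kappa. Proof. by rewrite /kappa; field. Qed.

Lemma deltaE : (1600 * delta) ^+ 2 = delta / 2.
Proof. by rewrite /delta; field. Qed.

Lemma rich_constE : rich_const * (delta / 2) = 64 + 128 / kappa ^+ 3.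
Proof. by rewrite /rich_const; field; rewrite !gt_eqF ?kappa_gt0 ?delta_gt0. Qed.

(* Sums the bounds of the three classes of points in [rich_le]. *)
Lemma rich_arith (K de ka C d n X Y Z nA nD : R) :
  0 < ka -> 0 < C -> de = 6 * ka -> de <= 1 / 2 -> K * de <= 1 -> 0 <= K ->
  (K * de) ^+ 2 = de / 2 -> C * (de / 2) = 64 + 128 / ka ^+ 3 ->
  0 < d -> 0 <= n -> d ^+ 2 <= 4 * n -> 0 <= X -> 0 <= Y -> 0 <= nA -> 0 <= nD ->
  nA <= (1 - de) * n -> nD <= K * de * n ->
  X * ((1 - ka) * d) ^+ 3 <=
    C * nA ^+ 2 + 4 * (nA * ((1 - ka) * d) ^+ 2) ->
  Y * ((1 - ka) * d) ^+ 3 <=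
    C * nD ^+ 2 + 4 * (nD * ((1 - ka) * d) ^+ 2) ->
  Z * (ka * d) ^+ 3 <= 128 * n ^+ 2 ->
  (X + Y + Z) * d ^+ 3 <= C * n ^+ 2.
Proof.
move=> k0 C0 kE de1 K1 K0 dE CE d0 n0 dn X0 Y0 A0 D0 hA hD hX hY hZ.
have de0 : 0 < de by lra.
have d3 : 0 < d ^+ 3 by rewrite exprn_gt0.
have N0 : 0 <= n ^+ 2 by rewrite exprn_ge0.
have hZ' : Z * d ^+ 3 <= 128 / ka ^+ 3 * n ^+ 2.
  rewrite mulrAC ler_pdivlMr ?exprn_gt0 //; move: hZ; rewrite exprMn; lra.
have nA2 : nA ^+ 2 <= (1 - de) ^+ 2 * n ^+ 2.
  by rewrite -exprMn ler_sqr ?nnegrE // mulr_ge0 //; lra.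
have nD2 : nD ^+ 2 <= de / 2 * n ^+ 2.
  by rewrite -dE -exprMn ler_sqr ?nnegrE // !mulr_ge0 //; lra.
have e2 : ((1 - ka) * d) ^+ 2 <= 4 * n.
  by apply: le_trans dn; rewrite exprMn ler_piMl ?exprn_ge0 ?ltW //; nra.
have lA : nA * ((1 - ka) * d) ^+ 2 <= 4 * n ^+ 2.
  apply: (@le_trans _ _ (n * (4 * n))); last by rewrite expr2; lra.
  by apply: ler_pM => //; [exact: sqr_ge0 | nra].
have lD : nD * ((1 - ka) * d) ^+ 2 <= 4 * n ^+ 2.
  apply: (@le_trans _ _ (n * (4 * n))); last by rewrite expr2; lra.
  apply: ler_pM => //; [exact: sqr_ge0 | apply: le_trans hD _].
  by rewrite ler_piMl //; lra.
have e3 : (1 - de / 2) * d ^+ 3 <= ((1 - ka) * d) ^+ 3.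
  by rewrite exprMn ler_pM2r // kE; nra.
set M := (X + Y) * d ^+ 3.
have hM : (1 - de / 2) * M <= (C * (1 - de) + 32) * n ^+ 2.
  have h1 : (1 - de / 2) * M <= (X + Y) * ((1 - ka) * d) ^+ 3.
    by rewrite mulrCA ler_wpM2l // addr_ge0.
  have h2 : C * (nA ^+ 2 + nD ^+ 2) <=
            C * (((1 - de) ^+ 2 + de / 2) * n ^+ 2).
    by rewrite ler_pM2l //; lra.
  have h3 : C * (((1 - de) ^+ 2 + de / 2) * n ^+ 2) <=
            C * ((1 - de) * n ^+ 2).
    by rewrite ler_pM2l // ler_wpM2r //; nra.
  lra.
have hM' : M <= (C * (1 - de / 2) + 64) * n ^+ 2.
  have e0 : 0 < 1 - de / 2 by lra.
  rewrite -(ler_pM2l e0); apply: le_trans hM _.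
  rewrite [leRHS]mulrA ler_wpM2r //.
  have : 0 <= C * de ^+ 2 by rewrite mulr_ge0 ?exprn_ge0 ?ltW.
  lra.
rewrite mulrDl -/M; have := congr1 (fun z => z * n ^+ 2) CE.
rewrite /=; lra.
Qed.

Lemma card_starD S A p : A \subset S ->
  #|star (S :\: A) p|%:R = #|star S p|%:R - #|star A p|%:R :> R.
Proof.
move=> /subsetP sAS.
have -> : star (S :\: A) p = star S p :\: star A p.
  by apply/setP => l; rewrite !inE; case: (l \in A); case: (on p l); rewrite ?andbF.
have : (#|star A p| + #|star S p :\: star A p| = #|star S p|)%N.
  rewrite -(cardsID (star A p) (star S p)) (setIidPr _) //.
  by apply/subsetP => l; rewrite !inE => /andP[/sAS -> ->].
by move=> /(congr1 (fun n => n%:R : R)); rewrite natrD => <-; rewrite addrAC subrr add0r.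
Qed.

(** Strong induction on the number of lines. The second term of the bound serves only the range
    [4 * #|S| <= d ^+ 2]; below it the first term suffices. *)
Lemma rich_le S Q (d : R) : 1 < d ->
  (forall p, p \in Q -> d <= #|star S p|%:R) ->
  #|Q|%:R * d ^+ 3 <= rich_const * #|S|%:R ^+ 2 + 4 * (#|S|%:R * d ^+ 2).
Proof.
have [n] := ubnP #|S|; elim: n => // n IH in S Q d *.
rewrite ltnS => Sn d1 hdeg.
have d0 : 0 < d by apply: lt_trans d1.
have C0 := rich_const_gt0; have k0 := kappa_gt0; have de0 := delta_gt0.
have S0 : 0 <= #|S|%:R :> R by [].
have d2 : 0 < d ^+ 2 by rewrite exprn_gt0.
have Sd : 0 <= #|S|%:R * d ^+ 2 by rewrite mulr_ge0 // ltW.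
have CS : 0 <= rich_const * #|S|%:R ^+ 2 by rewrite mulr_ge0 ?exprn_ge0 // ltW.
have [dS|dS] := lerP (4 * #|S|%:R) (d ^+ 2).
  have := very_rich_le d0 dS hdeg; rewrite -(ler_pM2r d2) => h.
  rewrite exprS mulrA; apply: le_trans h _; lra.
(* For bounded [d] the trivial count by pairs of lines is enough; for larger [d] the thresholds
   [kappa * d] and [(1 - kappa) * d] both exceed 1. *)
have [dk|dk] := lerP d kappa^-1.
  apply: ler_wpDr; first by rewrite mulr_ge0.
  have hd3 : d ^+ 3 <= rich_const.
    apply: le_trans rich_const_ge; rewrite -exprVn.
    by rewrite lerXn2r // nnegrE ltW // invr_gt0.
  rewrite mulrC; apply: ler_pM => //; first by rewrite exprn_ge0 // ltW.
  rewrite -natrX ler_nat; apply: rich_le_sqr => p /hdeg h.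
  by rewrite -(ltr_nat R); apply: lt_le_trans h.
have S1 : (0 < #|S|)%N by rewrite -(ltr_nat R); lra.
have S1R : 0 < #|S|%:R :> R by rewrite ltr0n.
have kd1 : 1 < kappa * d by rewrite -ltr_pdivrMl // mulr1.
have de1 := delta_le.
have de2 : delta <= 1 / 2 by lra.
have kE := kappaE.
have w0 : 0 < delta * #|S|%:R by rewrite mulr_gt0.
have [|z0 [sg [sg0]]] := @dense_disc R LT s S _ w0.
  by rewrite ler_piMl //; lra.
set A := finset _; set D := finset _ => wA hD.
have sAS : A \subset S by apply/subsetP => l; rewrite inE => /andP[].
have sDS : D \subset S by apply/subsetP => l; rewrite inE => /andP[].
have cA : #|S :\: A|%:R = #|S|%:R - #|A|%:R :> R.
  by rewrite cardsD (setIidPr sAS) natrB ?subset_leq_card.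
have ed1 : 1 < (1 - kappa) * d.
  apply: lt_le_trans kd1 _; rewrite ler_pM2r //; lra.
have ltA : (#|S :\: A| < n)%N.
  apply: leq_trans Sn; rewrite -(ltr_nat R) cA; lra.
have AleS : #|S :\: A|%:R <= (1 - delta) * #|S|%:R :> R by rewrite cA; lra.
have arith := fun X Y Z nD => @rich_arith 1600 delta kappa rich_const d #|S|%:R
  X Y Z #|S :\: A|%:R nD k0 C0 kE de2.
have K1 : 1600 * delta <= 1 by apply: le_trans de1 _; rewrite ler_pdivrMr // mul1r ler1n.
have Kge0 : 0 <= 1600 :> R by [].
have w2 : 1600 * delta * #|S|%:R <= 1 / 2 * #|S|%:R by rewrite ler_pM2r.
have wD (c : R) : c <= 1600 * (delta * #|S|%:R) -> c <= 1600 * delta * #|S|%:R.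
  by rewrite mulrA.
have {}arith X Y Z nD := arith X Y Z nD K1 Kge0 deltaE rich_constE d0 S0 (ltW dS).
apply: ler_wpDr; first by rewrite mulr_ge0.
(* In a disc of radius zero the lines are parallel, so each point loses at most one line when [A] is
   removed, and the induction applies to all of [Q]. *)
move: (sg0); rewrite le_eqVlt => /orP[/eqP sgE|sgt0].
  have hA p : #|star A p|%:R <= 1 :> R.
    rewrite (ler_nat R _ 1); apply/card_le1_eqP => l m.
    rewrite !inE -sgE => /andP[/andP[_ l0] pl] /andP[/andP[_ m0] pm].
    have z k : sqn (s k - z0) <= 0 -> s k = z0.
      by move=> h; apply/eqP; rewrite -subr_eq0 -sqn_eq0 eq_le h sqn_ge0.
    have e : s m = s l by rewrite (z _ m0) (z _ l0).
    by apply: lnI => //; move: pl pm; rewrite /incident e => /eqP -> /eqP /addrI.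
  have := arith #|Q|%:R 0 0 0; rewrite !addr0; apply => //.
  - by rewrite !mulr_ge0 // ltW.
  - apply: (IH (S :\: A) Q _ ltA ed1) => p pQ.
    rewrite card_starD //; move: (hA p) (hdeg _ pQ) => {de1 K1 Kge0 w2 wD hD}; lra.
  - by rewrite mul0r expr0n mulr0 mul0r mulr0 addr0.
  - by rewrite mul0r mulr_ge0 ?exprn_ge0.
have {}hD := hD sgt0.
pose B := S :\: D.
(* [Qo] stays rich for the lines off the disc, [Qi] for those in the larger disc; both are left to
   the induction. [Qg] is rich for both families and falls under [two_families]. *)
pose Qo := [set p in Q | #|star A p|%:R < kappa * d].
pose Qi := [set p in Q | #|star B p|%:R < kappa * d].
pose Qg := [set p in Q | (kappa * d <= #|star A p|%:R) && (kappa * d <= #|star B p|%:R)].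
have hQ : #|Q|%:R <= #|Qo|%:R + #|Qi|%:R + #|Qg|%:R :> R.
  rewrite -!natrD ler_nat.
  have /subset_leq_card : Q \subset Qo :|: Qi :|: Qg.
    apply/subsetP => p pQ; rewrite !inE pQ /=.
    by case: ltP => //= _; case: ltP.
  move=> h; apply: leq_trans h _; apply: leq_trans (leq_card_setU _ _) _.
  by rewrite leq_add2r leq_card_setU.
have cB : #|B|%:R = #|S|%:R - #|D|%:R :> R.
  by rewrite cardsD (setIidPr sDS) natrB ?subset_leq_card.
have hD' := wD _ hD.
have ltD := le_trans hD' w2.
have {}arith X Y Z X0 Y0 :=
  arith X Y Z #|D|%:R X0 Y0 (ler0n _ _) (ler0n _ _) AleS hD'.
move=> {de1 K1 Kge0 w2 wD hD hD'}.
apply: (@le_trans _ _ ((#|Qo|%:R + #|Qi|%:R + #|Qg|%:R) * d ^+ 3)).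
  by rewrite ler_wpM2r // exprn_ge0 // ltW.
apply: arith => //.
- apply: (IH (S :\: A) Qo _ ltA ed1) => p; rewrite inE => /andP[pQ hp].
  rewrite card_starD //; have := hdeg _ pQ; lra.
- apply: (IH D Qi _ _ ed1); first by apply: leq_trans Sn; rewrite -(ltr_nat R); lra.
  move=> p; rewrite inE => /andP[pQ hp]; have := hdeg _ pQ.
  have := card_starD p sDS; rewrite -/B; lra.
apply: le_trans (_ : 128 * (#|A|%:R * #|B|%:R) <= _).
  have kd2 : (kappa * d) ^+ 2 <= 4 * (delta / 2 * #|S|%:R).
    apply: (@le_trans _ _ (kappa ^+ 2 * (4 * #|S|%:R))).
      by rewrite exprMn ler_pM2l ?exprn_gt0 // ltW.
    rewrite mulrCA ler_pM2l // ler_pM2r //.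
    by rewrite kE expr2; nra.
  have h2 : delta / 2 * #|S|%:R <= 1 / 2 * #|S|%:R by rewrite ler_pM2r //; lra.
  apply: (@two_families R PT LT x y s t ptI lnI A B Qg z0 sg) => //.
  - by apply: lt_trans kd1.
  - by move=> l; rewrite inE => /andP[].
  - by move=> l; rewrite !inE => /andP[h lS]; move: h; rewrite lS /= -leNgt.
  - lra.
  - lra.
  - by move=> q; rewrite inE => /and3P[].
  - by move=> q; rewrite inE => /and3P[].
rewrite ler_pM2l // expr2; apply: ler_pM => //.
  by rewrite ler_nat subset_leq_card.
by rewrite ler_nat subset_leq_card // subsetDl.
Qed.

End RichPoints.

(** * From rich points to the incidence bound *)

Section SzemerediTrotter.
Variables (R : realType).

Lemma sum_inv_cube_le (k m : nat) : (0 < k)%N ->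
  \sum_(i < m) (k + i.+1)%:R ^- 3 <= k%:R ^- 2 - (k + m)%:R ^- 2 :> R.
Proof.
move=> k0; elim: m => [|m IH]; first by rewrite big_ord0 addn0 subrr.
rewrite big_ord_recr /=; apply: le_trans (lerD IH (lexx _)) _.
rewrite addnS -natr1; set u : R := (k + m)%:R.
have u0 : 0 < u by rewrite ltr0n addn_gt0 k0.
have u1 : 0 < u + 1 by lra.
suff : (u + 1) ^- 3 <= u ^- 2 - (u + 1) ^- 2 by lra.
have -> : u ^- 2 - (u + 1) ^- 2 = (2 * u + 1) / (u ^+ 2 * (u + 1) ^+ 2).
  by field; apply/andP; split; rewrite lt0r_neq0 //; lra.
rewrite ler_pdivlMr ?mulr_gt0 ?exprn_gt0 // mulrC ler_pdivrMr ?exprn_gt0 //.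
by rewrite [X in _ <= _ * X]exprS [leRHS]mulrA ler_pM2r ?exprn_gt0 //; nra.
Qed.

Lemma sum_layers (I : finType) (Q : {set I}) (f : I -> nat) (k m : nat) :
  (forall p, p \in Q -> (f p <= k + m)%N) ->
  (\sum_(p in Q) f p <=
   #|Q| * k + \sum_(i < m) #|[set p in Q | k + i.+1 <= f p]|)%N.
Proof.
move=> hf; rewrite -sum_nat_const.
have -> : (\sum_(i < m) #|[set p in Q | (k + i.+1 <= f p)%N]| =
    \sum_(p in Q) \sum_(i < m) (k + i.+1 <= f p)%N)%N.
  rewrite exchange_big /=; apply: eq_bigr => i _.
  rewrite -sum1_card big_mkcond [RHS]big_mkcond /=.
  by apply: eq_bigr => p _; rewrite inE; case: (p \in Q) => //=; case: leqP.
rewrite -big_split /=; apply: leq_sum => p /hf hp.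
have {hp} : (f p - k <= m)%N by rewrite leq_subLR.
rewrite -leq_subLR; elim: m {hf} => [|m IH]; first by rewrite leqn0 => /eqP ->.
rewrite leq_eqVlt => /orP[/eqP e|]; last first.
  by rewrite ltnS big_ord_recr /= => /IH h; apply: leq_trans h (leq_addr _ _).
rewrite e (eq_bigr (fun=> 1%N)) ?sum1_card ?card_ord // => i _.
by have hi := ltn_ord i; have -> : (k + i.+1 <= f p)%N by lia.
Qed.

Variables (PT LT : finType) (x y : PT -> R[i]) (s t : LT -> R[i]).
Hypothesis ptI : forall p q, x p = x q -> y p = y q -> p = q.
Hypothesis lnI : forall l m, s l = s m -> t l = t m -> l = m.

Local Notation deg p := #|pencil x y s t [set: LT] p|.

(** Layer-cake summation of the degrees with cutoff [k] just above the cube root [r] of [n]: degrees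
    up to [k] give about [n * r], and the levels [j > k], each of order [n ^ 2 / j ^ 3], sum to
    order [n ^ 2 / k ^ 2], at most [n * r]. *)
Lemma szemeredi_trotter (n : nat) : (0 < n)%N ->
  (#|PT| <= n)%N -> (#|LT| <= n)%N ->
  (\sum_p deg p)%:R <= (rich_const R + 20) * n%:R `^ (4 / 3).
Proof.
move=> n0 hP hL; pose N : R := n%:R; pose r := N `^ (1 / 3).
have N1 : 1 <= N by rewrite ler1n.
have N0 : 0 < N by lra.
have r0 : 0 < r by rewrite powR_gt0.
have r3 : r ^+ 3 = N.
  rewrite -powR_mulrn ?powR_ge0 // -powRrM (_ : 1 / 3 * 3%:R = 1); last by field.
  by rewrite powRr1 // ltW.
have [N0' r0'] : 0 <= N /\ 0 <= r by split; exact: ltW.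
have r1 : 1 <= r by rewrite -(@ler_pXn2r _ 3) ?nnegrE // r3 expr1n.
have -> : n%:R `^ (4 / 3) = N * r.
  rewrite /r -[X in _ = X * _]powRr1 // -powRD; last by apply/implyP => _; rewrite gt_eqF.
  by congr (_ `^ _); field.
have C0 := rich_const_gt0 R.
pose k := (Num.truncn r).+1.
have [rk kr] : r < k%:R /\ k%:R <= 2 * r.
  have /andP[h1 h2] := truncn_itv (ltW r0); split => //.
  by rewrite /k -natr1; lra.
pose H := [set p | 4 * N <= (deg p)%:R ^+ 2].
have LN : #|[set: LT]|%:R <= N by rewrite cardsT ler_nat.
rewrite (bigID (mem H)) /= natrD.
(* There are at most [sqrt n] points of such high degree, so their Bonferroni correction is linear
   in [n]. *)
have hH : (\sum_(p in H) deg p)%:R <= 2 * N.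
  pose d := Num.sqrt (4 * N).
  have d2 : d ^+ 2 = 4 * N by rewrite sqr_sqrtr // mulr_ge0.
  have d0 : 0 < d by rewrite sqrtr_gt0 mulr_gt0.
  have d0' := ltW d0.
  have := @very_rich_le R PT LT x y s t ptI lnI setT H d d0.
  rewrite d2 ler_pM2l // LN => /(_ isT).
  have hd p : p \in H -> d <= (deg p)%:R.
    by rewrite inE -d2 ler_sqr ?nnegrE.
  move=> /(_ hd) hk.
  have hk2 : #|H|%:R ^+ 2 <= N.
    have h4 : 0 < 4 * N by rewrite mulr_gt0.
    rewrite -(ler_pM2r h4) -{1}d2 -exprMn.
    apply: (@le_trans _ _ ((2 * N) ^+ 2)); last by rewrite exprMn expr2; lra.
    by rewrite ler_sqr ?nnegrE ?mulr_ge0 //; lra.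
  have := sum_star_le ptI lnI setT H; rewrite -(ler_nat R) natrD !natrM => hs.
  have : #|\bigcup_(p in H) pencil x y s t setT p|%:R <= N.
    by apply: le_trans LN; rewrite ler_nat subset_leq_card // subsetT.
  have : #|H|%:R * #|H|.-1%:R <= #|H|%:R ^+ 2 :> R.
    by rewrite expr2 ler_wpM2l // ler_nat leq_pred.
  lra.
have hM : (\sum_(p | p \notin H) deg p)%:R <= 2 * (N * r) + (rich_const R + 16) * (N * r).
  have -> : (\sum_(p | p \notin H) deg p = \sum_(p in ~: H) deg p)%N.
    by apply: eq_bigl => p; rewrite in_setC.
  have dn p : (deg p <= n)%N.
    by apply: leq_trans hL; rewrite -cardsT subset_leq_card // subsetT.
  have /(_ k n) := @sum_layers PT (~: H) (fun p => deg p).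
  move=> /(_ (fun p _ => leq_trans (dn p) (leq_addl _ _))).
  rewrite -(ler_nat R) natrD natrM [X in _ + X]natr_sum => h.
  apply: le_trans h _.
  apply: lerD.
    have h1 : #|~: H|%:R <= N by rewrite ler_nat; apply: leq_trans (max_card _) hP.
    have : #|~: H|%:R * k%:R <= N * (2 * r) by apply: ler_pM.
    lra.
  (* Outside [H] a nonempty level has [v ^+ 2 <= 4 * N], which turns the second term of [rich_le]
     into [16 * N ^+ 2]. *)
  have hm (i : 'I_n) : #|[set p in ~: H | (k + i.+1 <= deg p)%N]|%:R <=
      (rich_const R + 16) * N ^+ 2 * (k + i.+1)%:R ^- 3 :> R.
    set Q := finset _; set v : R := (k + i.+1)%:R.
    have v1 : 1 < v by rewrite ltr1n /k addSn addnS.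
    have v0 : 0 < v by lra.
    have v0' := ltW v0.
    have C0' : 0 <= rich_const R + 16 by lra.
    rewrite ler_pdivlMr ?exprn_gt0 //.
    have [->|[p0 p0Q]] := set_0Vmem Q.
      by rewrite cards0 mul0r mulr_ge0 ?exprn_ge0.
    have hQ p : p \in Q -> v <= (deg p)%:R by rewrite inE ler_nat => /andP[].
    apply: le_trans (rich_le ptI lnI v1 hQ) _.
    have vN : v ^+ 2 <= 4 * N.
      move: (p0Q); rewrite !inE -ltNge => /andP[/ltW h _]; apply: le_trans h.
      by rewrite ler_sqr ?nnegrE ?hQ.
    have a1 : rich_const R * #|[set: LT]|%:R ^+ 2 <= rich_const R * N ^+ 2.
      by rewrite ler_pM2l // ler_sqr ?nnegrE.
    have a2 : #|[set: LT]|%:R * v ^+ 2 <= N * (4 * N).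
      by apply: ler_pM => //; rewrite exprn_ge0.
    rewrite mulrDl; lra.
  apply: le_trans (_ : \sum_(i < n) (rich_const R + 16) * N ^+ 2 *
    (k + i.+1)%:R ^- 3 <= _); first by apply: ler_sum => i _; exact: hm.
  rewrite -mulr_sumr.
  have h1 := @sum_inv_cube_le k n isT.
  have h2 : k%:R ^- 2 <= r ^- 2.
    by rewrite lef_pV2 ?posrE ?exprn_gt0 // ?ltr0n // ler_sqr ?nnegrE // ltW.
  have h3 : 0 <= (k + n)%:R ^- 2 :> R by rewrite invr_ge0 exprn_ge0.
  have -> : N * r = N ^+ 2 * r ^- 2 by rewrite -r3; field; rewrite gt_eqF.
  rewrite mulrA ler_wpM2l //; first by rewrite mulr_ge0 ?exprn_ge0 //; lra.
  lra.
have : N <= N * r by rewrite ler_peMr.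
lra.
Qed.

End SzemerediTrotter.

(** * Transfer of polynomial systems to characteristic zero *)

Section Minors.
Variable A : comNzRingType.

Definition minor r (w : 'I_r -> {poly A}) (rho : 'I_r -> nat) : A :=
  \det (\matrix_(i, j) (w j)`_(rho i)).

Definition border T r (f : 'I_r -> T) (a : T) (i : 'I_r.+1) : T :=
  if unlift ord_max i is Some j then f j else a.

Lemma border_lift T r (f : 'I_r -> T) a i : border f a (lift ord_max i) = f i.
Proof. by rewrite /border liftK. Qed.

Lemma border_max T r (f : 'I_r -> T) a : border f a ord_max = a.
Proof. by rewrite /border unlift_none. Qed.

(** Laplace expansion along the added row: the cofactors do not depend on its index [k], so if all
    these minors vanish, the columns satisfy a linear relation. *)
Lemma minor_row r (w : 'I_r.+1 -> {poly A}) (rho : 'I_r -> nat) :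
  exists c : 'I_r.+1 -> A,
    (forall k, minor w (border rho k) = \sum_j (w j)`_k * c j) /\
    c ord_max = minor (fun j => w (lift ord_max j)) rho.
Proof.
pose N := \matrix_(i < r, j < r.+1) (w j)`_(rho i).
exists (fun j : 'I_r.+1 => (-1) ^+ (r + j) * \det (col' j N)); split=> [k|].
  rewrite /minor (expand_det_row _ ord_max); apply: eq_bigr => j _.
  rewrite mxE border_max /cofactor; congr (_ * (_ * \det _)).
  by apply/matrixP => a b; rewrite !mxE border_lift.
rewrite -signr_odd oddD addbb expr0 mul1r; congr (\det _).
by apply/matrixP => a b; rewrite !mxE.
Qed.

Lemma minor_col r (w : 'I_r -> {poly A}) (rho : 'I_r.+1 -> nat) :
  exists c : 'I_r.+1 -> A,
    forall v, minor (border w v) rho = \sum_i v`_(rho i) * c i.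
Proof.
pose N := \matrix_(i < r.+1, j < r) (w j)`_(rho i).
exists (fun i : 'I_r.+1 => (-1) ^+ (i + r) * \det (row' i N)) => v.
rewrite /minor (expand_det_col _ ord_max); apply: eq_bigr => i _.
rewrite mxE border_max /cofactor; congr (_ * (_ * \det _)).
by apply/matrixP => a b; rewrite !mxE border_lift.
Qed.

Lemma minor_repeat r (w : 'I_r -> {poly A}) (rho : 'I_r -> nat) m :
  (forall i, (rho i < m)%N) -> (m < r)%N -> minor w rho = 0.
Proof.
move=> hm mr.
have /injectivePn[i [j nij e]] : ~~ injectiveb (fun i => Ordinal (hm i)).
  apply/negP => /injectiveP /leq_card; rewrite !card_ord.
  by move=> h; move: mr; rewrite ltnNge h.
apply: (@determinant_alternate _ _ _ i j) => // k; rewrite !mxE.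
by case: e => ->.
Qed.

End Minors.

(** * Elimination of one variable *)

Section Elimination.
Variables (A : comNzRingType) (E : {poly A} -> Prop) (g : {poly A}) (B : nat).
Hypothesis B0 : (0 < B)%N.
Hypothesis sE : forall f, E f -> (size f <= B.+1)%N.
Hypothesis sg : (size g <= B.+1)%N.

(* Enough for the coefficients of [g ^+ B] and of the shifted generators used
   in [ideal_span]. *)
Definition rows := (B ^ 2 + 3 * B)%N.

Definition columns (w : {poly A}) : Prop :=
  exists f n, [/\ E f, (n + B < rows)%N & w = 'X^n * f].

Lemma size_columns w : columns w -> (size w <= rows)%N.
Proof.
move=> [f [n [/sE sf nB ->]]]; apply: leq_trans (size_polyMleq _ _) _.
rewrite size_polyXn /=; apply: leq_trans nB; rewrite -addnS leq_add2l.
exact: sf.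
Qed.

Lemma size_gB : (size (g ^+ B) <= rows)%N.
Proof.
apply: leq_trans (size_poly_exp_leq _ _) _.
have : ((size g).-1 * B <= B * B)%N.
  by rewrite leq_mul2r; apply/orP; right; move: sg; case: (size g).
rewrite /rows -mulnn => h; apply: leq_ltn_trans h _.
by rewrite -[X in (X < _)%N]addn0 ltn_add2l muln_gt0 B0.
Qed.

Definition minors r (e : A) : Prop := exists w (rho : 'I_r -> nat),
  [/\ forall j, columns (w j), forall i, (rho i < rows)%N & e = minor w rho].

Section Closed.
Variables (K : closedFieldType) (psi : {rmorphism A -> K}).
Local Notation "f ^psi" := (map_poly psi f) (at level 2, format "f ^psi").

Definition ideal (h : {poly K}) : Prop :=
  exists s : seq ({poly K} * {poly A}),
    (forall t, t \in s -> E t.2) /\ h = \sum_(t <- s) t.1 * t.2^psi.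

Lemma ideal0 : ideal 0.
Proof. by exists [::]; rewrite big_nil. Qed.

Lemma ideal_gen f : E f -> ideal f^psi.
Proof.
by move=> Ef; exists [:: (1, f)]; rewrite big_seq1 mul1r; split=> // t;
  rewrite inE => /eqP ->.
Qed.

Lemma idealD h k : ideal h -> ideal k -> ideal (h + k).
Proof.
move=> [s [hs ->]] [s' [hs' ->]]; exists (s ++ s'); rewrite big_cat; split=> // t.
by rewrite mem_cat => /orP[/hs|/hs'].
Qed.

Lemma idealM u h : ideal h -> ideal (u * h).
Proof.
move=> [s [hs ->]]; exists [seq (u * t.1, t.2) | t <- s]; split.
  by move=> _ /mapP[t /hs Et ->].
by rewrite big_map mulr_sumr; apply: eq_bigr => t _; rewrite mulrA.
Qed.

Definition span (h : {poly K}) : Prop :=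
  exists s : seq (K * {poly A}),
    (forall t, t \in s -> columns t.2) /\ h = \sum_(t <- s) t.1 *: t.2^psi.

Lemma spanD h k : span h -> span k -> span (h + k).
Proof.
move=> [s [hs ->]] [s' [hs' ->]]; exists (s ++ s'); rewrite big_cat; split=> // t.
by rewrite mem_cat => /orP[/hs|/hs'].
Qed.

Lemma span_sum (I : Type) (s : seq I) (P : pred I) (F : I -> {poly K}) :
  (forall i, P i -> span (F i)) -> span (\sum_(i <- s | P i) F i).
Proof.
by move=> h; elim/big_ind: _ => //; [exists [::]; rewrite big_nil | exact: spanD].
Qed.

Lemma span_mul (u : {poly K}) f : E f -> (size u + B <= rows)%N -> span (u * f^psi).
Proof.
move=> Ef su; rewrite -[u]coefK poly_def mulr_suml; apply: span_sum => i _.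
exists [:: (u`_i, 'X^i * f)]; rewrite big_seq1 /= rmorphM /= map_polyXn scalerAl.
split=> // t; rewrite inE => /eqP -> /=; exists f, i; split=> //.
by apply: leq_trans su; rewrite -addSn leq_add2r.
Qed.

(** Reducing all multipliers modulo one nonzero generator [f1] bounds their degrees; the quotients
    collect into a single multiple of [f1], whose degree is bounded because that of [h] is. *)
Lemma ideal_span h : ideal h -> (size h <= B ^ 2 + 2 * B)%N -> span h.
Proof.
move=> [s [hs hE]] sh.
case: (pselect (exists2 f1, E f1 & f1^psi != 0)) => [[f1 Ef1 nz]|all0]; last first.
  exists [::]; rewrite big_nil; split=> //; rewrite hE big_seq big1 // => t /hs Et.
  suff -> : t.2^psi = 0 by rewrite mulr0.
  by apply: contrapT => /eqP n0; apply: all0; exists t.2.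
pose h1 : {poly K} := \sum_(t <- s) (t.1 %% f1^psi) * t.2^psi.
pose U : {poly K} := \sum_(t <- s) (t.1 %/ f1^psi) * t.2^psi.
have hE' : h = h1 + U * f1^psi.
  rewrite hE /h1 /U mulr_suml -big_split /=; apply: eq_bigr => t _.
  by rewrite {1}(divp_eq t.1 f1^psi) mulrDl addrC mulrAC.
have sf f : E f -> (size f^psi <= B.+1)%N.
  by move=> /sE; apply: leq_trans; exact: size_poly.
have smod (u : {poly K}) : (size (u %% f1^psi)%R <= B)%N.
  by rewrite -ltnS (leq_trans _ (sf _ Ef1)) // ltn_modp.
have sh1 : (size h1 <= B ^ 2 + 2 * B)%N.
  rewrite /h1 big_seq; elim/big_ind: _ => [|a b ha hb|t /hs Et].
  - by rewrite size_poly0.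
  - by apply: leq_trans (size_polyD _ _) _; rewrite geq_max ha.
  apply: leq_trans (size_polyMleq _ _) _.
  apply: leq_trans (leq_addl _ _); rewrite mul2n -addnn.
  have := leq_add (smod t.1) (sf _ Et).
  by rewrite addnS -[X in (_ <= X)%N]/(B + B).+1; case: (_ + _)%N.
have sU : (size (U * f1^psi)%R <= B ^ 2 + 2 * B)%N.
  have -> : U * f1^psi = h - h1 by rewrite hE' addrC addKr.
  by apply: leq_trans (size_polyD _ _) _; rewrite size_polyN geq_max sh.
have rE : rows = (B ^ 2 + 2 * B + B)%N by rewrite /rows -addnA -mulSnr.
rewrite hE'; apply: spanD.
  rewrite /h1 big_seq; apply: span_sum => t /hs Et; apply: span_mul => //.
  rewrite rE leq_add2r; apply: leq_trans (smod _) _.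
  by rewrite mul2n -addnn addnA leq_addl.
apply: span_mul => //; rewrite rE leq_add2r.
have [->|nU] := eqVneq U 0; first by rewrite size_poly0.
apply: leq_trans sU; rewrite size_mul //.
by move: nz; rewrite -size_poly_gt0; case: (size f1^psi) => // n _; rewrite addnS leq_addr.
Qed.

(** A root of [h * 'X - 1] is not a root of [h]. *)
Lemma closed_nonroot (h : {poly K}) : h != 0 -> exists z, ~~ root h z.
Proof.
move=> nz; have : size (h * 'X - 1) != 1%N.
  have sX : size (h * 'X) = (size h).+1 by rewrite size_mulX.
  rewrite size_polyDl sX; first by rewrite eqSS size_poly_eq0.
  by rewrite size_polyN size_poly1 ltnS size_poly_gt0.
move=> /closed_rootP[z]; rewrite rootE !hornerE subr_eq0 => /eqP e.
exists z; rewrite rootE; apply/eqP => h0.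
by move: e; rewrite h0 mul0r => /esym/eqP; rewrite oner_eq0.
Qed.

(** An effective Nullstellensatz in one variable: the generator [e] of the ideal splits into at most
    [B] linear factors, and each of its roots, being common to [E], is a root of [g]. *)
Lemma ideal_gB :
  (forall z, (forall f, E f -> root f^psi z) -> root g^psi z) ->
  ideal (g ^+ B)^psi.
Proof.
move=> nox; rewrite rmorphXn /=.
case: (pselect (exists2 f1, E f1 & f1^psi != 0)) => [[f1 Ef1 nz]|all0]; last first.
  suff -> : g^psi = 0 by rewrite expr0n eqn0Ngt B0; exact: ideal0.
  apply: contrapT => /eqP /closed_nonroot[z /negP]; apply; apply: nox => f Ef.
  suff -> : f^psi = 0 by exact: root0.
  by apply: contrapT => /eqP n0; apply: all0; exists f.
pose P n := `[< exists h, [/\ ideal h, h != 0 & size h = n] >].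
have exP : exists n, P n.
  by exists (size f1^psi); apply/asboolP; exists f1^psi; split=> //; exact: ideal_gen.
case: (ex_minnP exP) => n /asboolP[e [ie nze se]] nmin.
have e_dvd f : E f -> e %| f^psi.
  move=> Ef; apply: contrapT => /negP; rewrite /dvdp => nmod.
  have imod : ideal (f^psi %% e).
    have -> : f^psi %% e = f^psi + (- (f^psi %/ e)) * e.
      by rewrite {2}(divp_eq f^psi e) mulNr addrAC subrr add0r.
    by apply: idealD; [exact: ideal_gen | exact: idealM].
  have : P (size (f^psi %% e)) by apply/asboolP; exists (f^psi %% e).
  by move=> /nmin; rewrite -se leqNgt ltn_modp nze.
have sE1 : (size e <= B.+1)%N.
  apply: leq_trans (sE Ef1); apply: (@leq_trans (size f1^psi)).
    by rewrite dvdp_leq // e_dvd.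
  exact: size_poly.
suff : e %| g^psi ^+ B by move=> /dvdpP[q ->]; exact: idealM.
have [rs eE] := closed_field_poly_normal e.
have srs : (size rs <= B)%N.
  move: sE1; rewrite eE size_scale ?lead_coef_eq0 // size_prod_XsubC ltnS.
  exact.
have rsg z : z \in rs -> root g^psi z.
  move=> zrs; apply: nox => f /e_dvd /root_dvdp; apply.
  by rewrite eE rootZ ?lead_coef_eq0 // root_prod_XsubC.
rewrite eE dvdpZl ?lead_coef_eq0 //.
apply: (@dvdp_trans _ (g^psi ^+ size rs)); last exact: dvdp_exp2l.
elim: rs rsg {eE srs} => [|z rs IH] rsg; first by rewrite big_nil.
rewrite big_cons exprS dvdp_mul //; last by apply: IH => u urs; rewrite rsg ?inE ?urs ?orbT.
by rewrite dvdp_XsubCl rsg ?inE ?eqxx.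
Qed.

End Closed.

Definition extends (E' : A -> Prop) (g' : A) : Prop :=
  forall (K : closedFieldType) (psi : {rmorphism A -> K}),
    (forall e, E' e -> psi e = 0) -> psi g' != 0 ->
    exists2 z, forall f, E f -> root (map_poly psi f) z & ~~ root (map_poly psi g) z.

Variables (F : fieldType) (phi : {rmorphism A -> F}) (a : F).
Hypothesis Ea : forall f, E f -> root (map_poly phi f) a.
Hypothesis ga : ~~ root (map_poly phi g) a.

(* [r] is the rank at [a] of the matrix of shifted generators: the minors of
   size [r + 1] vanish there, while bordering one of size [r] by [g ^+ B] gives
   a nonzero minor, since [g] does not vanish at [a]. *)
Lemma elimination : exists r (w : 'I_r -> {poly A}) (rho : 'I_r.+1 -> nat),
  [/\ (r <= rows)%N, forall j, columns (w j),
      forall e, minors r.+1 e -> phi e = 0,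
      phi (minor (border w (g ^+ B)) rho) != 0 &
      extends (minors r.+1) (minor (border w (g ^+ B)) rho)].
Proof.
pose P r := `[< exists2 e, minors r e & phi e != 0 >].
have exP : exists r, P r.
  exists 0%N; apply/asboolP; exists 1; last by rewrite rmorph1 oner_eq0.
  have no : 'I_0 -> False by case.
  exists (fun i => False_rect _ (no i)), (fun i => False_rect _ (no i)).
  by split=> [[]//|[]//|]; rewrite /minor det_mx00.
have Ple r : P r -> (r <= rows)%N.
  move=> /asboolP[e [w [rho [_ hrho ->]]]]; rewrite leqNgt.
  by apply: contra => h; rewrite (minor_repeat _ hrho h) rmorph0.
case: (ex_maxnP exP Ple) => r Pr rmax.
have rle := Ple _ Pr; move/asboolP: Pr => [_ [w [rho [hw hrho ->]]] nz].
have vanish e : minors r.+1 e -> phi e = 0.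
  move=> me; apply: contrapT => /eqP ne.
  have /rmax : P r.+1 by apply/asboolP; exists e.
  by rewrite ltnn.
have [c [cE cmax]] := minor_row (border w (g ^+ B)) rho.
(* Otherwise [minor_row] gives a linear relation between the columns and [g ^+ B]. At [a] the
   columns vanish, and what remains is the nonzero minor times [g ^+ B] evaluated at [a]. *)
have [k krows nzk] : exists2 k, (k < rows)%N &
    phi (minor (border w (g ^+ B)) (border rho k)) != 0.
  apply: contrapT => hn.
  have z k : (k < rows)%N -> phi (minor (border w (g ^+ B)) (border rho k)) = 0.
    by move=> hk; apply: contrapT => /eqP ne; apply: hn; exists k.
  have pz : \sum_j phi (c j) *: map_poly phi (border w (g ^+ B) j) = 0.
    apply/polyP => k; rewrite coef_sum coef0.
    have [hk|hk] := ltnP k rows; last first.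
      rewrite big1 // => j _; rewrite coefZ coef_map /=.
      rewrite nth_default ?rmorph0 ?mulr0 //; apply: leq_trans hk.
      by rewrite /border; case: unliftP => [j' _|_]; [exact/size_columns/hw | exact: size_gB].
    rewrite -[RHS](z k hk) cE rmorph_sum; apply: eq_bigr => j _.
    by rewrite coefZ coef_map /= rmorphM mulrC.
  have := congr1 (fun q => q.[a]) pz; rewrite horner0 horner_sum (bigD1 ord_max) //=.
  rewrite big1 ?addr0 => [|j nj].
    rewrite hornerZ border_max rmorphXn horner_exp cmax => /eqP.
    rewrite mulf_eq0 expf_eq0 B0 /= -rootE (negbTE ga) orbF.
    by rewrite (_ : (fun j => _) = w) ?(negbTE nz) //; apply/funext => j; rewrite border_lift.
  rewrite hornerZ /border; case: unliftP nj => [j' _ _|->]; last by rewrite eqxx.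
  have [f [n [Ef _ ->]]] := hw j'.
  by rewrite rmorphM hornerM (rootP (Ea Ef)) !mulr0.
exists r, w, (border rho k); split=> // K psi hE hg.
apply: contrapT => nox.
have nox' z : (forall f, E f -> root (map_poly psi f) z) -> root (map_poly psi g) z.
  by move=> h; apply: contrapT => /negP h'; apply: nox; exists z.
have sgB : (size (map_poly psi (g ^+ B)) <= B ^ 2 + 2 * B)%N.
  apply: leq_trans (size_poly _ _) _; apply: leq_trans (size_poly_exp_leq _ _) _.
  have : ((size g).-1 * B <= B * B)%N.
    by rewrite leq_mul2r; apply/orP; right; move: sg; case: (size g).
  move=> h; apply: leq_ltn_trans h _.
  by rewrite -mulnn -[X in (X < _)%N]addn0 ltn_add2l muln_gt0 B0.
(* Without a suitable [z], the image of [g ^+ B] is a combination of columns. The bordered minor is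
   linear in its last column, hence a combination of minors of size [r + 1], which vanish under
   [psi]. *)
have [s [hs sE']] := ideal_span (ideal_gB nox') sgB.
have [d dE] := minor_col w (border rho k).
suff /eqP : psi (minor (border w (g ^+ B)) (border rho k)) = 0 by rewrite (negbTE hg).
have linE v : psi (minor (border w v) (border rho k)) =
    \sum_i (map_poly psi v)`_(border rho k i) * psi (d i).
  by rewrite dE rmorph_sum; apply: eq_bigr => i _; rewrite coef_map rmorphM.
rewrite linE sE'.
under eq_bigr => i _ do rewrite coef_sum mulr_suml.
rewrite exchange_big /= big_seq big1 // => t /hs ct.
transitivity (t.1 * psi (minor (border w t.2) (border rho k))).
  by rewrite linE mulr_sumr; apply: eq_bigr => i _; rewrite coefZ mulrA.
rewrite hE ?mulr0 //; exists (border w t.2), (border rho k); split=> // i.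
  by rewrite /border; case: unliftP.
by rewrite /border; case: unliftP.
Qed.

End Elimination.

(** * Integer polynomials in several variables and their size *)

Fixpoint ZX (k : nat) : comNzRingType :=
  if k is k'.+1 then {poly ZX k'} : comNzRingType else int.

Section Evaluation.
Variables (F : comNzRingType) (a : nat -> F).

Fixpoint ev k : {rmorphism ZX k -> F} :=
  match k with
  | 0%N => intmul (1 : F) : {rmorphism int -> F}
  | k'.+1 => horner_eval (a k') \o map_poly (ev k')
               : {rmorphism {poly ZX k'} -> F}
  end.

Lemma evS k (f : ZX k.+1) : ev k.+1 f = (map_poly (ev k) f).[a k].
Proof. by []. Qed.

End Evaluation.

(* The sum of the absolute values of the coefficients, weighted by [2] to the
   total degree: [log2 (mu f)] bounds both the degree and the height of [f]. *)
Fixpoint mu (k : nat) : ZX k -> nat :=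
  match k with
  | 0%N => fun c : int => `|c|%N
  | k'.+1 => fun f : {poly ZX k'} => (\sum_(i < size f) mu f`_i * 2 ^ i)%N
  end.

Lemma muS k (f : {poly ZX k}) :
  @mu k.+1 f = (\sum_(i < size f) mu f`_i * 2 ^ i)%N.
Proof. by []. Qed.

Section MeasureStep.
Variable k : nat.
Hypothesis mu0 : mu (0 : ZX k) = 0%N.
Hypothesis mu_eq0 : forall f : ZX k, mu f = 0%N -> f = 0.
Hypothesis mu1 : mu (1 : ZX k) = 1%N.
Hypothesis muN : forall f : ZX k, mu (- f) = mu f.
Hypothesis muD : forall f g : ZX k, (mu (f + g)%R <= mu f + mu g)%N.
Hypothesis muM : forall f g : ZX k, (mu (f * g)%R <= mu f * mu g)%N.
Implicit Types f g : {poly ZX k}.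
Local Notation nu := (@mu k.+1).

Lemma mu_widen f m : (size f <= m)%N -> nu f = (\sum_(i < m) mu f`_i * 2 ^ i)%N.
Proof.
move=> hm; rewrite muS (big_ord_widen m (fun i => mu f`_i * 2 ^ i)%N) //.
rewrite big_mkcond; apply: eq_bigr => i _; case: ltnP => // h.
by rewrite nth_default // mu0.
Qed.

Lemma nu0 : nu 0 = 0%N.
Proof. by rewrite muS size_poly0 big_ord0. Qed.

Lemma nu_eq0 f : nu f = 0%N -> f = 0.
Proof.
move=> h; apply/eqP; rewrite -lead_coef_eq0; apply/eqP/mu_eq0.
move: h; rewrite muS; have [->|nz] := eqVneq f 0.
  by rewrite lead_coef0 mu0.
rewrite lead_coefE; move: nz; rewrite -size_poly_gt0; case: (size f) => // n _.
by rewrite big_ord_recr /= => /eqP; rewrite addn_eq0 muln_eq0 expn_eq0 orbF => /andP[_ /eqP].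
Qed.

Lemma nu1 : nu 1 = 1%N.
Proof. by rewrite muS size_poly1 big_ord1 coef1 mu1. Qed.

Lemma nuN f : nu (- f) = nu f.
Proof. by rewrite !muS size_polyN; apply: eq_bigr => i _; rewrite coefN muN. Qed.

Lemma nuD f g : (nu (f + g) <= nu f + nu g)%N.
Proof.
have hf : (size f <= maxn (size f) (size g))%N by rewrite leq_maxl.
have hg : (size g <= maxn (size f) (size g))%N by rewrite leq_maxr.
rewrite (mu_widen hf) (mu_widen hg) (mu_widen (size_polyD f g)).
rewrite -big_split /=; apply: leq_sum => i _.
by rewrite -mulnDl leq_mul2r coefD muD orbT.
Qed.

Lemma nu_sum (I : Type) (r : seq I) (P : pred I) (f : I -> {poly ZX k}) :
  (nu (\sum_(i <- r | P i) f i)%R <= \sum_(i <- r | P i) nu (f i))%N.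
Proof.
elim/big_rec2: _ => [|i m h _ IH]; first by rewrite nu0.
by apply: leq_trans (nuD _ _) _; rewrite leq_add2l.
Qed.

Lemma nuZ c f : (nu (c *: f) <= mu c * nu f)%N.
Proof.
rewrite (mu_widen (size_scale_leq c f)) muS big_distrr /=; apply: leq_sum => i _.
by rewrite coefZ mulnA leq_mul2r muM orbT.
Qed.

Lemma nuXn n f : (nu ('X^n * f) <= 2 ^ n * nu f)%N.
Proof.
have sz : (size ('X^n * f)%R <= n + size f)%N.
  by apply: leq_trans (size_polyMleq _ _) _; rewrite size_polyXn.
rewrite (mu_widen sz) big_split_ord /= big1 ?add0n => [|i _]; last first.
  by rewrite coefXnM ltn_ord mu0.
rewrite big_distrr /=; apply: leq_sum => i _.
by rewrite coefXnM ltnNge leq_addr /= addKn expnD mulnCA.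
Qed.

Lemma nuM f g : (nu (f * g)%R <= nu f * nu g)%N.
Proof.
rewrite -{1}[f]coefK poly_def mulr_suml; apply: leq_trans (nu_sum _ _ _) _.
rewrite [X in (_ <= X * _)%N]muS big_distrl /=; apply: leq_sum => i _.
rewrite -scalerAl; apply: leq_trans (nuZ _ _) _.
by rewrite -mulnA leq_mul2l nuXn orbT.
Qed.

End MeasureStep.

Lemma mu_axioms k : [/\ mu (0 : ZX k) = 0%N, forall f : ZX k, mu f = 0%N -> f = 0,
  mu (1 : ZX k) = 1%N, forall f : ZX k, mu (- f) = mu f &
  (forall f g : ZX k, (mu (f + g)%R <= mu f + mu g)%N) /\
  (forall f g : ZX k, (mu (f * g)%R <= mu f * mu g)%N)].
Proof.
elim: k => [|k [m0 meq0 m1 mN [mD mM]]].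
  split=> //=; first by move=> f /eqP; rewrite absz_eq0 => /eqP.
    by move=> f; rewrite abszN.
  by split=> f g; [lia | rewrite abszM].
split; [exact: nu0 | exact: nu_eq0 | exact: nu1 | exact: nuN |].
by split=> f g; [exact: nuD | exact: nuM].
Qed.

Section MeasureTheory.
Variable k : nat.
Implicit Types f g : ZX k.

Lemma mu0 : mu (0 : ZX k) = 0%N. Proof. by have [] := mu_axioms k. Qed.
Lemma mu_eq0 f : mu f = 0%N -> f = 0. Proof. by have [_ h _ _ _] := mu_axioms k; exact: h. Qed.
Lemma mu1 : mu (1 : ZX k) = 1%N. Proof. by have [] := mu_axioms k. Qed.
Lemma muN f : mu (- f) = mu f. Proof. by have [_ _ _ h _] := mu_axioms k; exact: h. Qed.
Lemma muD f g : (mu (f + g)%R <= mu f + mu g)%N.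
Proof. by have [_ _ _ _ [h _]] := mu_axioms k; exact: h. Qed.
Lemma muM f g : (mu (f * g)%R <= mu f * mu g)%N.
Proof. by have [_ _ _ _ [_ h]] := mu_axioms k; exact: h. Qed.

Lemma muB f g : (mu (f - g)%R <= mu f + mu g)%N.
Proof. by rewrite -(muN g) muD. Qed.

Lemma mu_sum (I : Type) (r : seq I) (P : pred I) (f : I -> ZX k) :
  (mu (\sum_(i <- r | P i) f i)%R <= \sum_(i <- r | P i) mu (f i))%N.
Proof.
elim/big_rec2: _ => [|i m h _ IH]; first by rewrite mu0.
by apply: leq_trans (muD _ _) _; rewrite leq_add2l.
Qed.

Lemma mu_prod (I : Type) (r : seq I) (P : pred I) (f : I -> ZX k) :
  (mu (\prod_(i <- r | P i) f i)%R <= \prod_(i <- r | P i) mu (f i))%N.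
Proof.
elim/big_rec2: _ => [|i m h _ IH]; first by rewrite mu1.
by apply: leq_trans (muM _ _) _; rewrite leq_mul2l IH orbT.
Qed.

Lemma muX f n : (mu (f ^+ n)%R <= mu f ^ n)%N.
Proof.
elim: n => [|n IH]; first by rewrite expr0 mu1.
by rewrite exprS expnS; apply: leq_trans (muM _ _) _; rewrite leq_mul2l IH orbT.
Qed.

Lemma mu_sign b f : mu ((-1) ^+ b * f) = mu f.
Proof.
by rewrite -signr_odd; case: odd; rewrite ?expr1 ?mulN1r ?muN ?expr0 ?mul1r.
Qed.

(** The bound varies with the column because a bordered minor has one column, from [g ^+ B], with
    much larger entries. *)
Lemma mu_det n (M : 'M[ZX k]_n) (b : 'I_n -> nat) :
  (forall i j, (mu (M i j) <= b j)%N) -> (mu (\det M) <= n`! * \prod_j b j)%N.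
Proof.
move=> hM; apply: leq_trans (mu_sum _ _ _) _.
have -> : (n`! = #|'S_n|)%N by rewrite card_Sn.
rewrite -sum_nat_const; apply: leq_sum => s _; rewrite mu_sign.
apply: leq_trans (mu_prod _ _ _) _.
rewrite [X in (_ <= X)%N](reindex_inj (@perm_inj _ s)) /=.
by apply: leq_prod => i _.
Qed.

End MeasureTheory.

Lemma mu_coef k (f : {poly ZX k}) i : (mu f`_i <= @mu k.+1 f)%N.
Proof.
have [hi|hi] := ltnP i (size f); last by rewrite nth_default // mu0.
rewrite muS (bigD1 (Ordinal hi)) //=; apply: leq_trans (leq_addr _ _).
by rewrite leq_pmulr // expn_gt0.
Qed.

Lemma size_mu k (f : {poly ZX k}) b : (@mu k.+1 f <= 2 ^ b)%N -> (size f <= b.+1)%N.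
Proof.
have [->|nz] := eqVneq f 0; first by rewrite size_poly0.
move=> h; rewrite leqNgt; apply/negP => hb; move: h; apply/negP; rewrite -ltnNge.
have hs : (0 < size f)%N by rewrite size_poly_gt0.
have hs1 : ((size f).-1 < size f)%N by rewrite ltn_predL.
rewrite muS (bigD1 (Ordinal hs1)) //=; apply: leq_trans (leq_addr _ _).
apply: (@leq_trans (2 ^ (size f).-1)%N).
  by rewrite ltn_exp2l // -ltnS prednK.
rewrite leq_pmull // lt0n -lead_coefE; apply/eqP => /mu_eq0/eqP.
by rewrite lead_coef_eq0 (negbTE nz).
Qed.

Lemma ev_ext (F : comNzRingType) (a b : nat -> F) k (f : ZX k) :
  (forall i, (i < k)%N -> a i = b i) -> ev a k f = ev b k f.
Proof.
elim: k f => // k IH f h; rewrite !evS h //; congr (_.[_]).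
by apply: eq_map_poly => c; apply: IH => i ik; apply: h; apply: ltnW.
Qed.

(** The inequality fails at [B = 6]; this is the origin of the threshold 7 below. *)
Lemma double_sqr_le B : (7 <= B)%N -> (2 * B ^ 2 <= 2 ^ B)%N.
Proof.
elim: B => // B IH; rewrite leq_eqVlt => /orP[/eqP [] <- //|].
rewrite ltnS => hB; rewrite -mulnn [(2 ^ B.+1)%N]expnS.
have h2 : (2 * B + 1 <= B * B)%N by nia.
by have := IH hB; rewrite -mulnn; move: (2 ^ B)%N => P; nia.
Qed.

Lemma fact_le_exp n m : (n <= m)%N -> (n`! <= m ^ n)%N.
Proof.
elim: n => // n IH hn; rewrite factS expnS; apply: leq_mul => //.
by apply: IH; apply: ltnW.
Qed.

(** As [r + 1 <= 2 * B ^ 2 <= 2 ^ B], the factorial is at most [2 ^ (B * r.+1)], and the total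
    exponent is at most [4 * B ^ 3 + B ^ 2 <= 5 * B ^ 3]. *)
Lemma minor_size_bound B r : (7 <= B)%N -> (r <= rows B)%N ->
  (r.+1`! * ((2 ^ B) ^ r.+1 * 2 ^ (B * B)) <= 2 ^ (B ^ 4))%N.
Proof.
move=> hB hr.
have hr2 : (r.+1 <= 2 * B ^ 2)%N.
  by move: hr; rewrite /rows -!mulnn => hr; nia.
have hf := fact_le_exp (leq_trans hr2 (double_sqr_le hB)).
apply: leq_trans (leq_mul hf (leqnn _)) _.
rewrite mulnA -!expnM -!expnD leq_exp2l //.
have : (B * r.+1 <= B * (2 * B ^ 2))%N by rewrite leq_mul2l hr2 orbT.
have -> : (B ^ 4 = B * (B * (B * B)))%N by rewrite !expnS expn0 muln1.
rewrite -!mulnn; have : (5 * (B * (B * B)) <= B * (B * (B * B)))%N.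
  by rewrite leq_mul2r; apply/orP; right; lia.
have : (B * B <= B * (B * B))%N by rewrite leq_mul2l leq_pmulr ?orbT //; lia.
set u := (B * (B * B))%N; have -> : (B * (2 * (B * B)) = 2 * u)%N by rewrite /u mulnCA.
lia.
Qed.

Lemma mu_coef_Xn k n (f : {poly ZX k}) i B :
  (@mu k.+1 f <= B)%N -> (mu ('X^n * f)`_i <= B)%N.
Proof.
move=> hf; rewrite coefXnM; case: ltnP => _; first by rewrite mu0.
exact: leq_trans (mu_coef _ _) hf.
Qed.

Lemma mu_border k r (w : 'I_r -> {poly ZX k}) (v : {poly ZX k}) rho B :
  (7 <= B)%N -> (r <= rows B)%N ->
  (forall j i, (mu (w j)`_i <= 2 ^ B)%N) -> (forall i, (mu v`_i <= 2 ^ (B * B))%N) ->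
  (mu (minor (border w v) rho) <= 2 ^ (B ^ 4))%N.
Proof.
move=> hB hr hw hv; pose b := border (fun _ : 'I_r => (2 ^ B)%N) (2 ^ (B * B))%N.
apply: leq_trans (mu_det (b := b) _) _.
  move=> i j; rewrite mxE /b /border; case: unliftP => [j' _|_]; first exact: hw.
  exact: hv.
apply: leq_trans (minor_size_bound hB hr); rewrite leq_mul2l; apply/orP; right.
rewrite (bigD1 ord_max) //= /b border_max mulnC leq_mul2r; apply/orP; right.
apply: (@leq_trans (\prod_(j < r.+1 | j != ord_max) 2 ^ B)%N).
  apply: leq_prod => j; rewrite /border; case: unliftP => // ->.
  by rewrite eqxx.
rewrite prod_nat_const cardC1 card_ord leq_exp2l //.
by rewrite -[1%N](expn0 2) ltn_exp2l // (leq_trans _ hB).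
Qed.

(** Induction on the number of variables. Each elimination replaces [B] by [B ^ 4], whence the
    exponent [B ^ (4 ^ k)]. Without variables, an integer smaller than [p] in absolute value that
    vanishes modulo [p] is zero. *)
Theorem transfer (p : nat) (K : numClosedFieldType) k :
  prime p -> forall (E : ZX k -> Prop) (g : ZX k) B (a : nat -> 'F_p),
  (7 <= B)%N -> (2 ^ (B ^ (4 ^ k)) < p)%N ->
  (forall f, E f -> (mu f <= 2 ^ B)%N) -> (mu g <= 2 ^ B)%N ->
  (forall f, E f -> ev a k f = 0) -> ev a k g != 0 ->
  exists b : nat -> K, (forall f, E f -> ev b k f = 0) /\ ev b k g != 0.
Proof.
move=> p_pr; elim: k => [|k IH] E g B a hB hp muE mug Ea ga.
  exists (fun=> 0); split=> [f Ef|]; last first.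
    by move: ga => /=; apply: contra; rewrite intr_eq0 => /eqP ->; rewrite rmorph0.
  suff -> : f = 0 by rewrite rmorph0.
  have := muE _ Ef; have /eqP := Ea _ Ef => /= e0 hf.
  have {}hf : (`|f| < p)%N.
    by apply: leq_ltn_trans hf _; move: hp; rewrite expn0 expn1.
  apply/eqP; rewrite -absz_eq0; apply: contraLR hf => nz; rewrite -leqNgt.
  apply: dvdn_leq; first by rewrite lt0n.
  rewrite (dvdn_pcharf (pchar_Fp p_pr)); move: e0; rewrite [f in f%:~R]intEsign.
  by rewrite rmorphM rmorph_sign mulf_eq0 signr_eq0.
have B0 : (0 < B)%N by apply: leq_trans hB.
have sE f : E f -> (size f <= B.+1)%N by move=> /muE; exact: size_mu.
have Ea' f : E f -> root (map_poly (ev a k) f) (a k).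
  by move=> /Ea e; apply/rootP.
have ga' : ~~ root (map_poly (ev a k) g) (a k) by rewrite rootE.
have [r [w [rho [hr hw van nz ext]]]] :=
  @elimination (ZX k) E g B B0 sE (size_mu mug) _ (ev a k) (a k) Ea' ga'.
have mucol v : columns E B v -> forall i, (mu v`_i <= 2 ^ B)%N.
  by move=> [f [n [Ef _ ->]]] i; apply: mu_coef_Xn; exact: muE.
have B4 : (7 <= B ^ 4)%N by apply: leq_trans hB _; rewrite -[X in (X <= _)%N]expn1 leq_pexp2l.
have pB4 : (2 ^ ((B ^ 4) ^ (4 ^ k)) < p)%N by rewrite -expnM -expnS.
have muE' e : minors E B r.+1 e -> (mu e <= 2 ^ (B ^ 4))%N.
  move=> [v [rho' [hv _ ->]]].
  have -> : v = border (fun j => v (lift ord_max j)) (v ord_max).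
    by apply/funext => j; rewrite /border; case: unliftP => [j'|] ->.
  apply: mu_border => // [j|i]; first exact: mucol.
  by apply: leq_trans (mucol _ (hv _) _) _; rewrite leq_exp2l // leq_pmulr.
have mug' : (mu (minor (border w (g ^+ B)) rho) <= 2 ^ (B ^ 4))%N.
  apply: mu_border => // [j|i]; first exact: mucol.
  apply: leq_trans (mu_coef _ _) _.
  by apply: leq_trans (muX (k := k.+1) _ _) _; rewrite expnM leq_exp2r.
have [b [bE bg]] := IH _ _ _ a B4 pB4 muE' mug' van nz.
have [z zE zg] := ext _ (ev b k) bE bg.
pose b' i := if i == k then z else b i.
have evE (f : {poly ZX k}) : ev b' k.+1 f = (map_poly (ev b k) f).[z].
  rewrite evS /b' eqxx; congr (_.[_]); apply: eq_map_poly => c.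
  by apply: ev_ext => i ik; rewrite ltn_eqF.
by exists b'; split=> [f /zE/rootP|]; rewrite evE // -rootE.
Qed.

Fixpoint var k (i : nat) : ZX k :=
  match k with
  | 0%N => (0 : int)
  | k'.+1 => (if i == k' then 'X else (var k' i)%:P) : {poly ZX k'}
  end.

Lemma ev_var (F : comNzRingType) (a : nat -> F) k i :
  (i < k)%N -> ev a k (var k i) = a i.
Proof.
elim: k => // k IH; rewrite ltnS evS /= => hi; case: eqVneq => [->|ni].
  by rewrite map_polyX hornerX.
by rewrite map_polyC hornerC /= IH // ltn_neqAle ni.
Qed.

Lemma mu_var k i : (mu (var k i) <= 2)%N.
Proof.
elim: k => //= k IH; case: eqP => _.
  by rewrite size_polyX !big_ord_recl big_ord0 !coefX mu0 mu1.
rewrite -muS (mu_widen (mu0 k) (size_polyC_leq1 _)) big_ord1 coefC eqxx muln1.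
exact: IH.
Qed.

Section Det3.
Variables (A : comNzRingType) (I : Type) (x y : I -> A).

Definition det3 i j l := (x j - x i) * (y l - y i) - (x l - x i) * (y j - y i).

End Det3.

Lemma ev_det3 (F : comNzRingType) (a : nat -> F) k (I : Type) (x y : I -> ZX k) i j l :
  ev a k (det3 x y i j l) = det3 (fun i => ev a k (x i)) (fun i => ev a k (y i)) i j l.
Proof. by rewrite /det3 !(rmorphB, rmorphM). Qed.

(** The unknowns are [m] abscissas and [m] ordinates; collinear triples give the equations, and all
    inequations are multiplied into one polynomial [g]. Its factors contribute exponents [2 * m ^ 2]
    and [5 * m ^ 3], together at most [7 * m ^ 3]. *)
Lemma lift_config (p : nat) (K : numClosedFieldType) m (u w : 'I_m -> 'F_p) :
  prime p -> (2 ^ ((7 * m ^ 3 + 7) ^ (4 ^ (2 * m))) < p)%N -> injective u ->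
  exists x y : 'I_m -> K, injective x /\
    forall i j l, (det3 x y i j l == 0) = (det3 u w i j l == 0).
Proof.
move=> p_pr hp uI; set B := (7 * m ^ 3 + 7)%N in hp.
pose k := (2 * m)%N.
pose a n : 'F_p := if insub n is Some i then u i else
                   if insub (n - m)%N is Some i then w i else 0.
pose X (i : 'I_m) := var k i; pose Y (i : 'I_m) := var k (m + i).
have ltX (i : 'I_m) : (i < k)%N by have := ltn_ord i; rewrite /k; lia.
have ltY (i : 'I_m) : (m + i < k)%N by have := ltn_ord i; rewrite /k; lia.
have aX (i : 'I_m) : a i = u i by rewrite /a valK.
have aY (i : 'I_m) : a (m + i)%N = w i.
  by rewrite /a insubF ?addKn ?valK // ltnNge leq_addr.
pose E f := exists i j l, det3 u w i j l = 0 /\ f = det3 X Y i j l.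
pose nz (t : 'I_m * 'I_m * 'I_m) := det3 u w t.1.1 t.1.2 t.2 != 0.
pose g := \prod_(ij : 'I_m * 'I_m | ij.1 != ij.2) (X ij.1 - X ij.2) *
  \prod_(t | nz t)
     det3 X Y t.1.1 t.1.2 t.2.
have evdet (F : comNzRingType) (b : nat -> F) i j l : ev b k (det3 X Y i j l) =
    det3 (fun i : 'I_m => b i) (fun i : 'I_m => b (m + i)%N) i j l.
  by rewrite ev_det3 /det3 /X /Y !ev_var.
have adet i j l : ev a k (det3 X Y i j l) = det3 u w i j l.
  by rewrite evdet /det3 !aX !aY.
have muB4 (f h : ZX k) : (mu f <= 2)%N -> (mu h <= 2)%N -> (mu (f - h) <= 4)%N.
  by move=> h1 h2; apply: leq_trans (muB _ _) _; lia.
have mudet i j l : (mu (det3 X Y i j l) <= 2 ^ 5)%N.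
  apply: leq_trans (muB _ _) _.
  by rewrite -[(2 ^ 5)%N]/(4 * 4 + 4 * 4)%N; apply: leq_add;
    apply: leq_trans (muM _ _) _; apply: leq_mul; apply: muB4; exact: mu_var.
have hB : (7 <= B)%N by rewrite /B leq_addl.
have mug : (mu g <= 2 ^ B)%N.
  apply: leq_trans (muM _ _) _.
  have h1 : (mu (\prod_(ij : 'I_m * 'I_m | ij.1 != ij.2) (X ij.1 - X ij.2)) <=
             2 ^ (2 * m ^ 2))%N.
    apply: leq_trans (mu_prod _ _ _) _.
    apply: (@leq_trans (\prod_(ij : 'I_m * 'I_m | ij.1 != ij.2) 2 ^ 2)%N).
      by apply: leq_prod => ij _; apply: muB4; exact: mu_var.
    rewrite prod_nat_const -expnM mulnC leq_exp2l // mulnC leq_mul2l /=.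
    by apply: leq_trans (max_card _) _; rewrite card_prod card_ord mulnn.
  have h2 : (mu (\prod_(t | nz t)
     det3 X Y t.1.1 t.1.2 t.2) <= 2 ^ (5 * m ^ 3))%N.
    apply: leq_trans (mu_prod _ _ _) _.
    apply: (@leq_trans (\prod_(t | nz t) 2 ^ 5)%N).
      by apply: leq_prod => t _; exact: mudet.
    rewrite prod_nat_const -expnM leq_exp2l // leq_mul2l /=.
    by apply: leq_trans (max_card _) _; rewrite !card_prod card_ord !expnS expn0 muln1 mulnA.
  apply: leq_trans (leq_mul h1 h2) _; rewrite -expnD leq_exp2l // /B.
  have : (m ^ 2 <= m ^ 3)%N by case: (m) => // m'; rewrite leq_pexp2l.
  lia.
have [b [bE bg]] : exists b : nat -> K, (forall f, E f -> ev b k f = 0) /\ ev b k g != 0.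
  apply: (@transfer p K k p_pr E g B a hB hp) => //.
  - move=> _ [i [j [l [_ ->]]]]; apply: leq_trans (mudet _ _ _) _.
    by rewrite leq_exp2l //; lia.
  - by move=> _ [i [j [l [e ->]]]]; rewrite adet.
  rewrite rmorphM !rmorph_prod mulf_neq0 //; apply/prodf_neq0.
    move=> ij nij; rewrite rmorphB /= /X !ev_var // !aX subr_eq0.
    by apply: contra nij => /eqP /uI ->.
  by move=> t ht; rewrite /= adet.
move: bg; rewrite rmorphM !rmorph_prod mulf_eq0 negb_or => /andP[/prodf_neq0 g1 /prodf_neq0 g2].
exists (fun i : 'I_m => b i), (fun i : 'I_m => b (m + i)%N); split.
  move=> i j e; apply/eqP/negPn/negP => nij.
  by have := g1 (i, j) nij; rewrite rmorphB /= /X !ev_var // e subrr eqxx.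
move=> i j l; have [e|ne] := eqVneq (det3 u w i j l) 0.
  by rewrite -evdet; apply/eqP; apply: bE; exists i, j, l.
by apply/negbTE; have := g2 ((i, j), l) ne; rewrite /= evdet.
Qed.

(** * Configurations over the prime field *)

Section Lines.
Variables (F : finFieldType) (lam : F).
Implicit Types (q : F * F) (l : {set F * F}).

(** The collinearity determinant after the shear adding [lam * y] to [x], which preserves lines and,
    for a good [lam], separates the abscissas. *)
Definition sdet q0 q1 q2 :=
  det3 (fun q => q.1 + lam * q.2) (fun q => q.2) q0 q1 q2.

Lemma sdet_on_line l q0 q1 q2 : is_line l ->
  q0 \in l -> q1 \in l -> q2 \in l -> sdet q0 q1 q2 = 0.
Proof.
move=> [a [b [c [ab ->]]]]; rewrite !inE => /eqP h0 /eqP h1 /eqP h2.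
have e1 : a * (q1.2 - q0.2) + b * (q1.1 - q0.1) = 0.
  by rewrite -[RHS](subrr 0) -{1}h1 -h0; ring.
have e2 : a * (q2.2 - q0.2) + b * (q2.1 - q0.1) = 0.
  by rewrite -[RHS](subrr 0) -{1}h2 -h0; ring.
have ea : a * sdet q0 q1 q2 = 0.
  transitivity ((q1.1 - q0.1) * (a * (q2.2 - q0.2) + b * (q2.1 - q0.1)) -
    (q2.1 - q0.1) * (a * (q1.2 - q0.2) + b * (q1.1 - q0.1))).
    by rewrite /sdet /det3; ring.
  by rewrite e1 e2 !mulr0 subrr.
have eb : b * sdet q0 q1 q2 = 0.
  transitivity ((q2.2 - q0.2) * (a * (q1.2 - q0.2) + b * (q1.1 - q0.1)) -
    (q1.2 - q0.2) * (a * (q2.2 - q0.2) + b * (q2.1 - q0.1))).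
    by rewrite /sdet /det3; ring.
  by rewrite e1 e2 !mulr0 subrr.
apply/eqP; move/eqP: ea; rewrite mulf_eq0 => /orP[/eqP a0|//].
move/eqP: eb; rewrite mulf_eq0 => /orP[/eqP b0|//].
by case: ab; rewrite a0 b0.
Qed.

Lemma sdet_line l q0 q1 q2 : is_line l -> q0 != q1 ->
  q0 \in l -> q1 \in l -> sdet q0 q1 q2 = 0 -> q2 \in l.
Proof.
move=> [a [b [c [ab ->]]]] nq; rewrite !inE => /eqP h0 /eqP h1 hd.
have e1 : a * (q1.2 - q0.2) + b * (q1.1 - q0.1) = 0.
  by rewrite -[RHS](subrr 0) -{1}h1 -h0; ring.
set z := a * q2.2 + b * q2.1 + c.
have zE : z = a * (q2.2 - q0.2) + b * (q2.1 - q0.1).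
  by rewrite -[LHS]subr0 -h0 /z; ring.
have ex : (q1.1 - q0.1) * z = 0.
  transitivity (a * sdet q0 q1 q2 +
     (q2.1 - q0.1) * (a * (q1.2 - q0.2) + b * (q1.1 - q0.1))).
    by rewrite zE /sdet /det3; ring.
  by rewrite hd e1 !mulr0 addr0.
have ey : (q1.2 - q0.2) * z = 0.
  transitivity ((q2.2 - q0.2) * (a * (q1.2 - q0.2) + b * (q1.1 - q0.1)) -
     b * sdet q0 q1 q2).
    by rewrite zE /sdet /det3; ring.
  by rewrite hd e1 !mulr0 subr0.
move/eqP: ex; rewrite mulf_eq0 => /orP[|//]; rewrite subr_eq0 => /eqP x01.
move/eqP: ey; rewrite mulf_eq0 => /orP[|//]; rewrite subr_eq0 => /eqP y01.
by case/negP: nq; rewrite -pair_eqE /= x01 y01 !eqxx.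
Qed.

Lemma line_subset l l' q0 q1 : is_line l -> is_line l' -> q0 != q1 ->
  q0 \in l -> q1 \in l -> q0 \in l' -> q1 \in l' -> l \subset l'.
Proof.
move=> hl hl' nq h0 h1 h0' h1'; apply/subsetP => q hq.
by apply: (sdet_line hl' nq h0' h1'); exact: (sdet_on_line hl).
Qed.

End Lines.

(** Each pair of points with distinct ordinates excludes a single [lam], and there are fewer pairs
    than field elements. *)
Lemma exists_shear (F : finFieldType) (P : {set F * F}) : (#|P| ^ 2 < #|F|)%N ->
  exists lam : F, {in P &, injective (fun q => q.1 + lam * q.2)}.
Proof.
move=> hP; pose bad (qq : (F * F) * (F * F)) :=
  (qq.2.1 - qq.1.1) / (qq.1.2 - qq.2.2).
have /subsetPn[lam _ hlam] : ~~ ([set: F] \subset [set bad qq | qq in setX P P]).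
  apply/negP => /subset_leq_card; rewrite cardsT leqNgt; apply/negP/negPn.
  by apply: leq_ltn_trans hP; rewrite -mulnn -cardsX leq_imset_card.
exists lam => q q' qP q'P e.
have e' : lam * (q.2 - q'.2) = q'.1 - q.1.
  by rewrite mulrBr; apply/eqP; rewrite subr_eq addrAC -e addrAC subrr add0r.
have [y0|ny] := eqVneq (q.2 - q'.2) 0.
  move: e'; rewrite y0 mulr0 => /esym/eqP; rewrite subr_eq0 => /eqP x0.
  move/eqP: y0; rewrite subr_eq0 => /eqP y0.
  by apply/eqP; rewrite -pair_eqE /= x0 y0 !eqxx.
case/negP: hlam; apply/imsetP; exists (q, q'); first by rewrite inE qP.
by rewrite /bad /= -e' mulfK.
Qed.

Lemma card_incidences (F : finFieldType) (P : {set F * F}) (L : {set {set F * F}}) :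
  #|incidences P L| = (\sum_(l in L) #|[set q in P | q \in l]|)%N.
Proof.
rewrite -sum1_card.
transitivity (\sum_(l in L) \sum_(q in P | q \in l) 1)%N; last first.
  by apply: eq_bigr => l _; rewrite -sum1_card; apply: eq_bigl => q; rewrite inE.
rewrite (exchange_big_dep (mem P)) /= => [|l q _ /andP[] //].
rewrite pair_big_dep /=; apply: eq_bigl => -[q l] /=.
by rewrite !inE /=; case: (q \in P); case: (l \in L); case: (q \in l).
Qed.

(** Shear, lift the points to the complex plane, and replace each line by the one through the lifts
    of two of its points. Since collinearity of triples is preserved both ways, so are the
    incidences. *)
Lemma upper_bound (R : realType) p n (P : {set 'F_p * 'F_p}) (L : {set {set 'F_p * 'F_p}}) :
  prime p -> (0 < n)%N -> (2 ^ ((7 * n ^ 3 + 7) ^ (4 ^ (2 * n))) < p)%N ->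
  (forall l, l \in L -> is_line l) -> (#|P| <= n)%N -> (#|L| <= n)%N ->
  #|incidences P L|%:R <= (rich_const R + 21) * n%:R `^ (4 / 3).
Proof.
move=> p_pr n0 hp hL cP cL.
have hp' : (2 ^ ((7 * #|P| ^ 3 + 7) ^ (4 ^ (2 * #|P|))) < p)%N.
  apply: leq_ltn_trans hp; rewrite leq_exp2l //.
  have hb : (7 * #|P| ^ 3 + 7 <= 7 * n ^ 3 + 7)%N by rewrite leq_add2r leq_mul2l leq_exp2r.
  apply: (@leq_trans ((7 * n ^ 3 + 7) ^ (4 ^ (2 * #|P|)))).
    by rewrite leq_exp2r // expn_gt0.
  by rewrite leq_pexp2l ?addn_gt0 ?orbT // leq_exp2l // leq_mul2l.
have [lam lamI] : exists lam : 'F_p, {in P &, injective (fun q => q.1 + lam * q.2)}.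
  apply: exists_shear; rewrite card_Fp //; apply: leq_ltn_trans hp.
  apply: (@leq_trans (n ^ 2)); first by rewrite leq_exp2r.
  apply: ltnW; apply: (@leq_ltn_trans (7 * n ^ 3 + 7)).
    apply: (@leq_trans (n ^ 3)); first by rewrite leq_pexp2l.
    by apply: leq_trans (leq_addr _ _); rewrite leq_pmull.
  apply: leq_ltn_trans (ltn_expl _ _) => //.
  by rewrite -{1}[(_ + 7)%N]expn1 leq_pexp2l ?addn_gt0 ?orbT ?expn_gt0.
set m := #|P| in hp' *.
pose pt (i : 'I_m) := enum_val i.
have ptP i : pt i \in P by exact: enum_valP.
pose u i := (pt i).1 + lam * (pt i).2; pose w i := (pt i).2.
have uI : injective u by move=> i j /(lamI _ _ (ptP i) (ptP j)) /enum_val_inj.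
have [x [y [xI hdet]]] := @lift_config p R[i] m u w p_pr hp' uI.
have sE i j k : det3 u w i j k = sdet lam (pt i) (pt j) (pt k) by [].
(* The other lines carry at most one point each; their at most [n] incidences raise the constant
   from 20 to 21. *)
pose L2 := [set l in L | (1 < #|[set q in P | q \in l]|)%N].
pose ln (j : 'I_#|L2|) := enum_val j.
have lnL2 j : ln j \in L2 by exact: enum_valP.
have lnL j : is_line (ln j) by apply: hL; have := lnL2 j; rewrite inE => /andP[].
have hij j : exists ij : 'I_m * 'I_m, [/\ ij.1 != ij.2, pt ij.1 \in ln j & pt ij.2 \in ln j].
  have := lnL2 j; rewrite inE => /andP[_ /card_gt1P[q [q' []]]].
  rewrite !inE => /andP[qP ql] /andP[q'P q'l] nq.
  exists (enum_rank_in qP q, enum_rank_in qP q').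
  rewrite /pt /= !enum_rankK_in //; split=> //; apply: contra nq => /eqP e.
  by rewrite -(enum_rankK_in qP qP) -(enum_rankK_in qP q'P) e.
have [f hf] := fin_all_exists hij.
pose s j := (y (f j).2 - y (f j).1) / (x (f j).2 - x (f j).1).
pose t j := y (f j).1 - s j * x (f j).1.
have dx j : x (f j).2 - x (f j).1 != 0.
  by rewrite subr_eq0 eq_sym; have [n12 _ _] := hf j; apply: contra n12 => /eqP /xI ->.
have onE i j : incident x y s t i j = (det3 x y (f j).1 (f j).2 i == 0).
  have -> : det3 x y (f j).1 (f j).2 i =
      (x (f j).2 - x (f j).1) * (y i - (s j * x i + t j)).
    by rewrite /t /s /det3; field.
  by rewrite mulf_eq0 (negbTE (dx j)) /= subr_eq0.
have onP i j : incident x y s t i j = (pt i \in ln j).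
  rewrite onE hdet sE; have [n12 h1 h2] := hf j; apply/eqP/idP => h.
    apply: (sdet_line (lnL j) _ h1 h2 h).
    by apply: contra n12 => /eqP /enum_val_inj ->.
  exact: (sdet_on_line _ (lnL j)).
have ptI i j : x i = x j -> y i = y j -> i = j by move=> /xI.
have lnI j k : s j = s k -> t j = t k -> j = k.
  move=> sE' tE; apply: enum_val_inj.
  have sub j' k' : s j' = s k' -> t j' = t k' -> ln j' \subset ln k'.
    move=> s' t'; have [n12 h1 h2] := hf j'.
    apply: (@line_subset _ 0 _ _ (pt (f j').1) (pt (f j').2)) => //.
    - by apply: contra n12 => /eqP /enum_val_inj ->.
    - by rewrite -onP /incident -s' -t'; rewrite -onP in h1.
    - by rewrite -onP /incident -s' -t'; rewrite -onP in h2.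
  by apply/eqP; rewrite eqEsubset !sub.
have cL2 : (#|'I_(#|L2|)| <= n)%N.
  rewrite card_ord; apply: leq_trans cL; apply: subset_leq_card.
  by apply/subsetP => l; rewrite inE => /andP[].
have cm : (#|'I_m| <= n)%N by rewrite card_ord.
have st := @szemeredi_trotter R _ _ x y s t ptI lnI n n0 cm cL2.
have hI : (#|incidences P L| <= n + \sum_i #|pencil x y s t [set: 'I_#|L2|] i|)%N.
  rewrite card_incidences (bigID (mem L2)) /= addnC; apply: leq_add.
    apply: leq_trans cL; rewrite -sum1_card.
    rewrite big_mkcond [X in (_ <= X)%N]big_mkcond /=; apply: leq_sum => l _.
    by rewrite inE; case: (l \in L) => //=; case: ltnP.
  rewrite (eq_bigl (mem L2)); last by move=> l; rewrite /= [l \in L2]inE; case: (l \in L).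
  rewrite big_enum_val (eq_bigr (fun j => \sum_(i < m) incident x y s t i j)%N); last first.
    move=> j _; rewrite -[LHS]sum1_card.
    transitivity (\sum_(q in P) (q \in ln j))%N.
      rewrite big_mkcond [RHS]big_mkcond /=; apply: eq_bigr => q _.
      by rewrite inE; case: (q \in P) => //=; case: (q \in ln j).
    by rewrite big_enum_val; apply: eq_bigr => i _; rewrite onP.
  rewrite exchange_big /=; apply: leq_sum => i _.
  rewrite -[X in (_ <= X)%N]sum1_card [X in (_ <= X)%N]big_mkcond /=.
  apply: leq_sum => j _; by rewrite !inE; case: (incident _ _ _ _ _ _).
have n1 : 1 <= n%:R :> R by rewrite ler1n.
have nn : n%:R <= n%:R `^ (4 / 3) :> R.
  by rewrite -[X in X <= _]powRr1 // ler_powR //; lra.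
move: hI; rewrite -(ler_nat R) natrD; lra.
Qed.

(** * Unfolding the iterated logarithm *)

Lemma logb_gt (R : realType) (b k : nat) (x : R) :
  (1 < b)%N -> k%:R < logb b%:R x -> (b ^ k)%:R < x.
Proof.
move=> b1; have bR : 1 < b%:R :> R by rewrite ltr1n.
have lb : 0 < ln (b%:R : R) by rewrite ln_gt0.
rewrite /logb ltr_pdivlMr // => h.
have x0 : 0 < x.
  rewrite ltNge; apply/negP => /ln0 lx; move: h; rewrite lx ltNge => /negP; apply.
  by rewrite mulr_ge0 // ltW.
have b0 : 0 < b%:R :> R by lra.
have bk : 0 < b%:R ^+ k :> R by rewrite exprn_gt0.
by rewrite natrX -ltr_ln ?posrE // lnXn // -[X in X < _]mulr_natl.
Qed.

Lemma tower_lt (R : realType) (p n : nat) :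
  5 * n%:R < logb 2 (logb 6 (logb 18 (p%:R : R))) - 1 ->
  (18 ^ (6 ^ (2 ^ (5 * n + 1))) < p)%N.
Proof.
move=> h; have {h} : (5 * n + 1)%:R < logb 2 (logb 6 (logb 18 (p%:R : R))).
  by rewrite natrD natrM; lra.
move=> /(@logb_gt R 2 _ _ isT) /(@logb_gt R 6 _ _ isT) /(@logb_gt R 18 _ _ isT).
by rewrite ltr_nat.
Qed.

(** Splitting [2 ^ (5 * n + 1)] as [2 ^ n.+1 * 4 ^ (2 * n)] leaves [7 * n ^ 3 + 7 <= 36 ^ (2 ^ n)]
    to be checked. *)
Lemma lifting_bound n : (0 < n)%N ->
  (2 ^ ((7 * n ^ 3 + 7) ^ (4 ^ (2 * n))) <= 18 ^ (6 ^ (2 ^ (5 * n + 1))))%N.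
Proof.
move=> n0.
suff h : ((7 * n ^ 3 + 7) ^ (4 ^ (2 * n)) <= 6 ^ (2 ^ (5 * n + 1)))%N.
  apply: (@leq_trans (18 ^ ((7 * n ^ 3 + 7) ^ (4 ^ (2 * n))))%N).
    by rewrite leq_exp2r // expn_gt0 addn_gt0 orbT.
  by rewrite leq_exp2l.
have -> : (6 ^ (2 ^ (5 * n + 1)) = (36 ^ (2 ^ n)) ^ (4 ^ (2 * n)))%N.
  have -> : (36 ^ (2 ^ n) = 6 ^ (2 ^ n.+1))%N by rewrite expnS expnM.
  have -> : (4 ^ (2 * n) = 2 ^ (4 * n))%N by rewrite !expnM.
  by rewrite -expnM -expnD; congr (_ ^ (_ ^ _))%N; lia.
rewrite leq_exp2r ?expn_gt0 //.
have h2 : (n < 2 ^ n)%N by exact: ltn_expl.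
apply: (@leq_trans (36 ^ n.+1)); last by rewrite leq_exp2l.
have h3 : (n ^ 3 <= 36 ^ n)%N.
  apply: (@leq_trans ((2 ^ n) ^ 3)); first by rewrite leq_exp2r // ltnW.
  by rewrite -expnM mulnC expnM leq_exp2r.
have h4 : (0 < 36 ^ n)%N by rewrite expn_gt0.
rewrite [(36 ^ n.+1)%N]expnS; lia.
Qed.

(** * Grids with many incidences *)

Lemma natF_inj p i j : prime p -> (i < p)%N -> (j < p)%N ->
  i%:R = j%:R :> 'F_p -> i = j.
Proof.
move=> p_pr ip jp /(congr1 (fun z : 'F_p => z : nat)).
by rewrite /= !val_Fp_nat // !modn_small.
Qed.

Lemma cube_root_floor n : (2 <= n)%N ->
  exists2 k, (0 < k)%N & (2 * k ^ 3 <= n < 2 * k.+1 ^ 3)%N.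
Proof.
move=> n2; pose P k := (2 * k ^ 3 <= n)%N.
have P1 : exists k, P k by exists 1%N.
have Ple k : P k -> (k <= n)%N.
  rewrite /P => h; apply: leq_trans h; case: k => // k.
  by rewrite 2!expnS mulnA; nia.
case: (ex_maxnP P1 Ple) => k Pk kmax; exists k; first exact: (kmax 1%N).
by rewrite [(2 * k ^ 3 <= n)%N]Pk /= ltnNge; apply/negP => /kmax; rewrite ltnn.
Qed.

Section Grid.
Variables (p k : nat).
Hypothesis p_pr : prime p.
Hypothesis k0 : (0 < k)%N.
Hypothesis kp : (2 * k ^ 3 < p)%N.

Definition grid_line (a b : nat) : {set 'F_p * 'F_p} :=
  [set q | 1 * q.2 + (- a%:R) * q.1 + (- b%:R) == 0].

Definition grid : {set 'F_p * 'F_p} :=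
  [set (ij.1%:R, ij.2%:R) | ij : 'I_k * 'I_(2 * k ^ 2)].

Definition grid_lines : {set {set 'F_p * 'F_p}} :=
  [set grid_line ab.1 ab.2 | ab : 'I_k * 'I_(k ^ 2)].

Lemma grid_lineE (a b x y : nat) : ((x%:R, y%:R) \in grid_line a b) =
  (y%:R == (a * x + b)%:R :> 'F_p).
Proof.
rewrite inE /= mul1r mulNr natrD natrM -[RHS]subr_eq0.
by congr (_ == _); ring.
Qed.

Lemma grid_lines_line l : l \in grid_lines -> is_line l.
Proof.
move=> /imsetP[ab _ ->]; exists 1, (- ab.1%:R), (- ab.2%:R); split=> //.
Qed.

Lemma card_grid : (#|grid| <= 2 * k ^ 3)%N.
Proof.
apply: leq_trans (leq_imset_card _ _) _; rewrite card_prod !card_ord.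
by rewrite mulnCA -expnS.
Qed.

Lemma card_grid_lines : (#|grid_lines| <= k ^ 3)%N.
Proof.
by apply: leq_trans (leq_imset_card _ _) _; rewrite card_prod !card_ord -expnS.
Qed.

(** Each line meets each of the [k] columns of the grid, as [a * x + b < 2 * k ^ 2]. All parameters
    are below [p], and a line determines [b] and [a] by its values at abscissas 0 and 1, so nothing
    is counted twice. *)
Lemma grid_incidences : (k ^ 4 <= #|incidences grid grid_lines|)%N.
Proof.
have small i : (i <= 2 * k ^ 2)%N -> (i < p)%N.
  move=> hi; apply: leq_ltn_trans kp; apply: leq_trans hi _.
  by rewrite leq_mul2l leq_pexp2l.
have kk : (k <= k ^ 2)%N by rewrite -{1}[k]expn1 leq_pexp2l.
pose f (t : 'I_k * 'I_k * 'I_(k ^ 2)) : ('F_p * 'F_p) * {set 'F_p * 'F_p} :=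
  ((t.1.1%:R, (t.1.2 * t.1.1 + t.2)%:R), grid_line t.1.2 t.2).
have fI : injective f.
  move=> [[x a] b] [[x' a'] b'] /=; rewrite /f /= => e.
  have ex : x%:R = x'%:R :> 'F_p by have /(congr1 (fun z => z.1.1)) := e.
  have el : grid_line a b = grid_line a' b' by have /(congr1 snd) := e.
  have eb : (b%:R == b'%:R :> 'F_p).
    have : (0%:R, b%:R) \in grid_line a b by rewrite grid_lineE muln0.
    by rewrite el grid_lineE muln0.
  have bb : b = b'.
    apply: val_inj; apply: (natF_inj p_pr _ _ (eqP eb)); apply: small;
      by apply: leq_trans (ltnW (ltn_ord _)) _; rewrite leq_pmull.
  have ea : ((a + b)%:R == (a' + b')%:R :> 'F_p).
    have : (1%:R, (a + b)%:R) \in grid_line a b by rewrite grid_lineE muln1.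
    by rewrite el grid_lineE muln1.
  have aa : a = a'.
    move: ea; rewrite bb !natrD => /eqP /addIr ea.
    apply: val_inj; apply: (natF_inj p_pr _ _ ea); apply: small;
      apply: leq_trans (ltnW (ltn_ord _)) _; lia.
  have xx : x = x'.
    apply: val_inj; apply: (natF_inj p_pr _ _ ex); apply: small;
      apply: leq_trans (ltnW (ltn_ord _)) _; lia.
  by rewrite xx aa bb.
have <- : #|[set f t | t : 'I_k * 'I_k * 'I_(k ^ 2)]| = (k ^ 4)%N.
  by rewrite card_imset // !card_prod !card_ord mulnn -expnD.
apply: subset_leq_card; apply/subsetP => _ /imsetP[[[x a] b] _ ->].
rewrite inE inE /= grid_lineE eqxx andbT; apply/andP; split; last first.
  by apply/imsetP; exists (a, b).
have hy : (a * x + b < 2 * k ^ 2)%N.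
  have := leq_mul (ltnW (ltn_ord a)) (ltnW (ltn_ord x)); have := ltn_ord b.
  by rewrite mulnn; lia.
by apply/imsetP; exists (x, Ordinal hy).
Qed.

End Grid.

Lemma lower_bound (R : realType) p n : prime p -> (8 <= n < p)%N ->
  exists (P : {set 'F_p * 'F_p}) (L : {set {set 'F_p * 'F_p}}),
    [/\ forall l, l \in L -> is_line l, (#|P| <= n)%N, (#|L| <= n)%N &
        81^-1 * n%:R `^ (4 / 3) <= #|incidences P L|%:R :> R].
Proof.
move=> p_pr /andP[n8 np].
have [|k k0 /andP[kn nk]] := @cube_root_floor n; first by apply: leq_trans n8.
have kp : (2 * k ^ 3 < p)%N by apply: leq_ltn_trans np.
exists (grid p k), (grid_lines p k); split.
- exact: grid_lines_line.
- exact: leq_trans (card_grid _ _) kn.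
- by apply: leq_trans (card_grid_lines _ _) _; apply: leq_trans kn; rewrite leq_pmull.
have := grid_incidences p_pr k0 kp; rewrite -(ler_nat R); apply: le_trans.
rewrite mulrC ler_pdivrMr //.
(* From [n < 2 * k.+1 ^ 3 <= 16 * k ^ 3]; the fourth power of [3 * k] then gives the constant 81. *)
have hn : n%:R <= (3 * k)%:R ^+ 3 :> R.
  rewrite -natrX ler_nat; apply: ltnW; apply: leq_trans nk _.
  apply: (@leq_trans (2 * (2 * k) ^ 3)); first by rewrite leq_mul2l leq_exp2r //; lia.
  by rewrite !expnMn mulnA leq_mul2r orbT.
have h4 : 0 <= 4 / 3 :> R by lra.
have k3 : 0 <= (3 * k)%:R :> R by [].
have := ge0_ler_powR h4 _ _ hn; rewrite !nnegrE exprn_ge0 // => /(_ (ler0n _ _) isT) h.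
apply: le_trans h _; rewrite -powR_mulrn // -powRrM.
have -> : 3%:R * (4 / 3) = 4%:R :> R by field.
by rewrite powR_mulrn // -natrX -[81]/(81%:R) -natrM expnMn mulnC.
Qed.

Theorem theorem2p3 (R : realType) :
  (exists c : R, 0 < c /\
    forall p n : nat, prime p -> (0 < n)%N ->
      5 * n%:R < logb 2 (logb 6 (logb 18 (p%:R : R))) - 1 ->
      forall (P : {set 'F_p * 'F_p}) (L : {set {set 'F_p * 'F_p}}),
        (forall l, l \in L -> is_line l) ->
        (#|P| <= n)%N -> (#|L| <= n)%N ->
        #|incidences P L|%:R <= c * n%:R `^ (4 / 3))
  /\
  (exists c' : R, 0 < c' /\
    forall p n : nat, prime p -> (8 <= n)%N ->
      5 * n%:R < logb 2 (logb 6 (logb 18 (p%:R : R))) - 1 ->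
      exists (P : {set 'F_p * 'F_p}) (L : {set {set 'F_p * 'F_p}}),
        [/\ forall l, l \in L -> is_line l,
            (#|P| <= n)%N, (#|L| <= n)%N &
            c' * n%:R `^ (4 / 3) <= #|incidences P L|%:R]).
Proof.
split.
  exists (rich_const R + 21); split; first by have := rich_const_gt0 R; lra.
  move=> p n p_pr n0 /tower_lt hp P L hL cP cL; apply: upper_bound => //.
  exact: leq_ltn_trans (lifting_bound n0) hp.
exists 81^-1; split; first by rewrite invr_gt0.
move=> p n p_pr n8 /tower_lt hp; apply: lower_bound => //; rewrite n8.
have n0 : (0 < n)%N by apply: leq_trans n8.
apply: leq_ltn_trans hp; apply: leq_trans (lifting_bound n0).
(* Only [n < p] is needed here, so the tower bound is used very wastefully. *)
apply: (@leq_trans (7 * n ^ 3 + 7)).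
  by apply: leq_trans (leq_addr _ _); rewrite (@leq_trans (n ^ 3)) ?leq_pmull // -{1}[n]expn1 leq_pexp2l.
apply: leq_trans (ltnW (ltn_expl _ _)) => //.
by rewrite -{1}[(_ + 7)%N]expn1 leq_pexp2l ?addn_gt0 ?orbT ?expn_gt0.
Qed.
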